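(* Let $$\Omega:=\Big\{x\in\mathbb{R}^3:\ |x\cdot n|<\tfrac12,\ |x\cdot b_{32}|<\tfrac12,\ |x\cdot d|<\tfrac12\Big\}$$ and let $F=\frac12e^{(2)}+\frac12e^{(3)}$. Then there exist $\epsilon_0=\epsilon_0(\Omega,F,K)>0$ and $C=C(\Omega,F,K)>1$ such that for every $\epsilon\in(0,\epsilon_0)$ there exist a map $u_\epsilon\in\mathcal{A}_F$ whose restriction to $\Omega$ belongs to $C^{0,1}(\Omega;\mathbb{R}^3)$ and $\chi_\epsilon\in BV(\Omega;\{e^{(2)},e^{(3)}\})$ with $$E_{el}(u_\epsilon,\chi_\epsilon)+\epsilon E_{surf}(\chi_\epsilon)\le C\epsilon^{\frac23}.$$
   Context: $K:=\{e^{(1)},e^{(2)},e^{(3)}\}$ with $e^{(1)}=\mathrm{diag}(-2,1,1)$, $e^{(2)}=\mathrm{diag}(1,-2,1)$, $e^{(3)}=\mathrm{diag}(1,1,-2)$. For $M\in\mathbb{R}^{3\times3}$, $e(M)=\frac12(M+M^t)$. The vectors $$n:=\tfrac{1}{\sqrt6}(-2,1,1)^t,\qquad b_{32}:=\tfrac1{\sqrt2}(0,-1,1)^t,\qquad d:=\tfrac1{\sqrt3}(1,1,1)^t$$ form an orthonormal basis of $\mathbb{R}^3$. The energies are $$E_{el}(u,\chi):=\int_\Omega|e(\nabla u)-\chi|^2\,dx,\qquad E_{surf}(\chi):=|D\chi|(\Omega)$$ with $|D\chi|(\Omega)$ the total variation of $D\chi$ in $\Omega$, and $$\mathcal{A}_F:=\{u\in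 H^1_{loc}(\mathbb{R}^3;\mathbb{R}^3):\ u(x)=Fx+b\text{ in }\mathbb{R}^3\setminus\overline\Omega\text{ for some }b\in\mathbb{R}^3\}.$$ $C^{0,1}$ denotes Lipschitz functions. *)

(* Defs.v *)
From HB Require Import structures.
From mathcomp Require Import all_boot all_order all_algebra.
From mathcomp Require Import all_classical all_reals all_analysis.

Set Implicit Arguments.
Unset Strict Implicit.
Unset Printing Implicit Defensive.

Import Order.TTheory GRing.Theory Num.Theory.
Import numFieldNormedType.Exports.

Local Open Scope classical_set_scope.
Local Open Scope ring_scope.

Section Euclidean.
Context {R : realType}.

Definition vec3 (a b c : R) : 'cV[R]_3 := \col_(i < 3) [:: a; b; c]`_i.

Definition diag3 (a b c : R) : 'M[R]_3 := diag_mx (\row_(i < 3) [:: a; b; c]`_i).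

Definition dot (x y : 'cV[R]_3) : R := \sum_(i < 3) x i 0 * y i 0.

(* Square of the Euclidean (Frobenius) norm; the library norm `|A| of a matrix
   is the maximum of the absolute values of its entries. *)
Definition sqnorm (m n : nat) (A : 'M[R]_(m, n)) : R :=
  \sum_(i < m) \sum_(j < n) A i j ^+ 2.

Definition sym_part (M : 'M[R]_3) : 'M[R]_3 := 2^-1 *: (M + M^T).

End Euclidean.

Lemma sigma_finite_product d1 d2 (T1 : measurableType d1)
    (T2 : measurableType d2) (R : realType)
    (m1 : {sigma_finite_measure set T1 -> \bar R})
    (m2 : {sigma_finite_measure set T2 -> \bar R}) :
  sigma_finite setT (m1 \x m2)%E.
Proof.
have /sigma_finiteP[F [TF ndF Foo]] := sigma_finiteT m1.
have /sigma_finiteP[G [TG ndG Goo]] := sigma_finiteT m2.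
exists (fun n => F n `*` G n).
  rewrite -setXTT TF TG predeqE => -[x y]; split.
    move=> [/= [n _ Fnx] [k _ Gky]]; exists (maxn n k) => //; split.
    - by move: x Fnx; exact/subsetPset/ndF/leq_maxl.
    - by move: y Gky; exact/subsetPset/ndG/leq_maxr.
  by move=> [n _ []/= ? ?]; split; exists n.
move=> k; have [? ?] := Foo k; have [? ?] := Goo k.
split; first exact: measurableX.
by rewrite product_measure1E// lte_mul_pinfty// ge0_fin_numE.
Qed.

Section Lebesgue.
Variable R : realType.

Definition coords2 := (measurableTypeR R * measurableTypeR R)%type.
Definition coords3 := (coords2 * measurableTypeR R)%type.

(* Matrices carry no measurable structure in the library, so measurability and
   integrals over R^3 = 'cV[R]_3 are pulled back along this coordinate bijection
   to the threefold product of the Lebesgue measure. *)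
Definition of_coords (p : coords3) : 'cV[R]_3 := vec3 p.1.1 p.1.2 p.2.

Definition lebesgue2 : set coords2 -> \bar R :=
  (@lebesgue_measure R \x @lebesgue_measure R)%E.

HB.instance Definition _ := Measure.on lebesgue2.
HB.instance Definition _ := Measure_isSigmaFinite.Build _ _ _ lebesgue2
  (@sigma_finite_product _ _ _ _ _ (@lebesgue_measure R) (@lebesgue_measure R)).

Definition lebesgue3 : set coords3 -> \bar R :=
  (lebesgue2 \x @lebesgue_measure R)%E.

HB.instance Definition _ := Measure.on lebesgue3.
HB.instance Definition _ := Measure_isSigmaFinite.Build _ _ _ lebesgue3
  (@sigma_finite_product _ _ _ _ _ lebesgue2 (@lebesgue_measure R)).

Definition measurable3 (A : set 'cV[R]_3) (f : 'cV[R]_3 -> R) : Prop :=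
  measurable_fun (of_coords @^-1` A) (f \o of_coords).

Definition integral3 (A : set 'cV[R]_3) (f : 'cV[R]_3 -> R) : \bar R :=
  (\int[lebesgue3]_(p in of_coords @^-1` A) (f (of_coords p))%:E)%E.

Definition integrable3 (A : set 'cV[R]_3) (f : 'cV[R]_3 -> R) : Prop :=
  lebesgue3.-integrable (of_coords @^-1` A) (EFin \o f \o of_coords).

End Lebesgue.

Section FunctionSpaces.
Context {R : realType}.
Implicit Types (Omega : set 'cV[R]_3) (phi : 'cV[R]_3 -> R).

Definition pderiv (j : 'I_3) phi (x : 'cV[R]_3) : R := 'D_(delta_mx j 0) phi x.

(* C^1_c(Omega), as functions on R^3 supported in Omega. *)
Definition C1c Omega phi : Prop :=
  [/\ continuous phi,
      forall (j : 'I_3) x, derivable phi x (delta_mx j 0),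
      forall j : 'I_3, continuous (pderiv j phi),
      compact (closure [set x | phi x != 0])
    & closure [set x | phi x != 0] `<=` Omega].

Definition L2loc (m n : nat) (f : 'cV[R]_3 -> 'M[R]_(m, n)) : Prop :=
  (forall i j, measurable3 setT (fun x => f x i j)) /\
  (forall A : set 'cV[R]_3, compact A ->
     (integral3 A (fun x => sqnorm (f x)) < +oo)%E).

(* The entry (i, j) of the matrix field Du is the j-th weak derivative of u_i
   on R^3. *)
Definition weak_gradient (u : 'cV[R]_3 -> 'cV[R]_3)
    (Du : 'cV[R]_3 -> 'M[R]_3) : Prop :=
  forall (i j : 'I_3) phi, C1c setT phi ->
    integral3 setT (fun x => u x i 0 * pderiv j phi x) =
    (- integral3 setT (fun x => (Du x i j * phi x)%R))%E.

(* u is in H^1_loc(R^3; R^3) and Du is its weak gradient. The gradient is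
   carried along as a representative; it is determined by u up to a Lebesgue
   null set. *)
Definition H1loc (u : 'cV[R]_3 -> 'cV[R]_3)
    (Du : 'cV[R]_3 -> 'M[R]_3) : Prop :=
  [/\ L2loc u, L2loc Du & weak_gradient u Du].

(* u belongs to A_F, and Du is its weak gradient. *)
Definition admissible Omega (F : 'M[R]_3) (u : 'cV[R]_3 -> 'cV[R]_3)
    (Du : 'cV[R]_3 -> 'M[R]_3) : Prop :=
  H1loc u Du /\
  exists b : 'cV[R]_3, forall x, ~ closure Omega x -> u x = F *m x + b.

(* |D chi|(Omega), by duality: the supremum of the integrals of
   \sum_(i, j) chi_ij div(phi_ij) over C^1_c(Omega) test fields
   phi_ij = (phi 0 i j, phi 1 i j, phi 2 i j) with |phi| <= 1 pointwise. *)
Definition variation3 Omega (chi : 'cV[R]_3 -> 'M[R]_3) : \bar R :=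
  ereal_sup [set r | exists2 phi : 'I_3 -> 'I_3 -> 'I_3 -> 'cV[R]_3 -> R,
    (forall k i j, C1c Omega (phi k i j)) /\
    (forall x, \sum_k \sum_i \sum_j phi k i j x ^+ 2 <= 1)
    & r = integral3 Omega (fun x =>
            \sum_i \sum_j chi x i j * \sum_k pderiv k (phi k i j) x)].

Definition BV Omega (V : set 'M[R]_3) (chi : 'cV[R]_3 -> 'M[R]_3) : Prop :=
  [/\ forall x, Omega x -> V (chi x),
      forall i j, integrable3 Omega (fun x => chi x i j)
    & (variation3 Omega chi < +oo)%E].

(* E_el(u, chi), where Du is the weak gradient of u. *)
Definition elastic_energy Omega (Du chi : 'cV[R]_3 -> 'M[R]_3) : \bar R :=
  integral3 Omega (fun x => sqnorm (sym_part (Du x) - chi x)).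

Definition surface_energy Omega (chi : 'cV[R]_3 -> 'M[R]_3) : \bar R :=
  variation3 Omega chi.

End FunctionSpaces.

Section CubicToTetragonal.
Variable R : realType.

Definition e2 : 'M[R]_3 := diag3 1 (-2) 1.
Definition e3 : 'M[R]_3 := diag3 1 1 (-2).

Definition vn : 'cV[R]_3 := (Num.sqrt 6)^-1 *: vec3 (-2) 1 1.
Definition vb32 : 'cV[R]_3 := (Num.sqrt 2)^-1 *: vec3 0 (-1) 1.
Definition vd : 'cV[R]_3 := (Num.sqrt 3)^-1 *: vec3 1 1 1.

Definition cubeOmega : set 'cV[R]_3 :=
  [set x | [/\ `|dot x vn| < 2^-1, `|dot x vb32| < 2^-1 & `|dot x vd| < 2^-1]].

Definition Fhalf : 'M[R]_3 := 2^-1 *: e2 + 2^-1 *: e3.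

End CubicToTetragonal.

Arguments cubeOmega R : clear implicits.

(* Main.v *)
Require Import Defs.
From mathcomp Require Import all_boot all_order all_algebra.
From mathcomp Require Import all_classical all_reals all_analysis.
From mathcomp Require Import measurable_realfun ring lra.

(** Branching microstructure of Kohn-Mueller type on the rotated cube.

    Put y = x.b32 and b23 = (0,1,1)/sqrt 2, a vector in the span of n and d. The
    wells satisfy e^(2) - F = F - e^(3) = diag(0,-3/2,3/2), and this matrix is
    the symmetric part of 3 b23 b32^t. Hence for u = F x + 3 g b23 and
    chi = F + sigma (e^(2) - F) with sigma = +-1, the elastic error
    e(grad u) - chi is the symmetric part of 3 b23 (grad g - sigma b32)^t
    (strain_error_entry). It remains to find a scalar g, zero off the cube, with
    derivative sigma = +-1 in the direction b32, small derivatives in the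
    directions n and d, and few jumps of sigma.

    The function g depends only on y and on the depth, that is the distance to
    the four faces normal to n and d. It is obtained from the tent 1/2 - |y| by
    successive reflections w -> min(w, 2c - w). A reflection preserves the modulus
    1 of the slope in y, and it halves the period of the wave when c is half the
    height. If the threshold c of generation j sinks linearly to this value while
    the depth decreases through a layer, the wave refines from period 2^-j to
    2^-(j+1) across the layer, at the cost of a slope of c in the depth. The layer
    of generation j has thickness of order 3^(m-j). Then the elastic energies of
    the layers j >= m are of order 4^-m (3/4)^(j-m), their surface energies of
    order 2^m (2/3)^(j-m), and both sums converge. After n generations the wave is
    cut off by the depth, and the bottom layer costs its thickness 3^(m-n). The
    choice m = 2q and n = 5q gives an elastic energy of order 16^-q (elastic_le)
    and a surface energy of order 4^q (strain_variation), and 4^q ~ eps^(-1/3)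
    makes both contributions of order eps^(2/3).

    The analysis rests on difference quotients. As translations preserve Lebesgue
    measure, a difference quotient can be moved from a test function to the
    function tested (cvg_difference_quotient). Since g is made of affine functions
    by minima and maxima, its forward quotients converge at every point, and their
    limit is the weak gradient (weak_derivative). For chi the same identity bounds
    the total variation by the measure of the set of points that a step of length
    h carries across a jump, divided by h (variation3_le). These points lie in the
    sets critical m n h of points close to a kink of g. Their measure is computed
    by Fubini in the coordinates x.n, x.d, x.b32 (lebesgue3_rotate): the number of
    kinks of the wave in y at most doubles with each reflection, and generation j
    occupies an area of order 3^(m-j), so the total is O(2^m h)
    (critical_measure). Off the null set of points that are critical at all
    scales, the increments of g over short steps, hence its slopes, are known up to
    the slope of the threshold (wave_increment, slope_layer). *)

Set Implicit Arguments.
Unset Strict Implicit.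
Unset Printing Implicit Defensive.
Import Order.TTheory GRing.Theory Num.Theory.
Import numFieldNormedType.Exports.
Local Open Scope classical_set_scope.
Local Open Scope ring_scope.

(** * Folding a tent *)

Section Folding.
Context {R : realType}.
Implicit Types (c : nat -> R) (y h : R) (i j n : nat).

(** The tent 1/2 - |y| reflected downwards at the heights c 0, c 1, ... in turn.
    Every reflection preserves the modulus 1 of the slope. *)
Fixpoint fold_wave c n y : R :=
  if n is i.+1 then Num.min (fold_wave c i y) (2 * c i - fold_wave c i y)
  else 2^-1 - `|y|.

(** The slope of the folded tent off its kinks: it changes sign whenever a
    reflection acts. *)
Fixpoint fold_sign c n y : R :=
  if n is i.+1 then
    if fold_wave c i y < c i then fold_sign c i y else - fold_sign c i y
  else if y < 0 then 1 else -1.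

Lemma fold_sign_pm1 c n y : fold_sign c n y = 1 \/ fold_sign c n y = -1.
Proof.
elim: n => [|n IH] /=; first by case: ifP; [left|right].
by case: ifP => _ //; case: IH => ->; [right|left; rewrite opprK].
Qed.

Lemma eq_fold c c' n y : (forall i, (i < n)%N -> c i = c' i) ->
  fold_wave c n y = fold_wave c' n y /\ fold_sign c n y = fold_sign c' n y.
Proof.
elim: n => [//|n IH] cc' /=.
by have [//|-> ->] := IH; [move=> i /ltnW; exact: cc'|rewrite cc'].
Qed.

Lemma fold_wave_le c n y : fold_wave c n.+1 y <= c n.
Proof. by rewrite /= ge_min; have [|] := leP (fold_wave c n y) (c n); lra. Qed.

(** A reflection at height c n.+1 keeps a value nonnegative when that value is at
    most 2 c n.+1, and the preceding reflection has brought it below c n. *)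
Lemma fold_wave_ge0 c n y : `|y| <= 2^-1 -> 2^-1 <= 2 * c 0%N ->
  (forall i, (i < n)%N -> c i <= 2 * c i.+1) -> 0 <= fold_wave c n y.
Proof.
move=> y2 c0; elim: n => [_|n IH cc] /=; first lra.
rewrite le_min IH ?subr_ge0/=; last by move=> i /ltnW; exact: cc.
case: n cc {IH} => [|n] cc; first by rewrite /=; have := normr_ge0 y; lra.
by rewrite (le_trans (fold_wave_le c n y))// cc.
Qed.

(** After the reflection at c j the wave lies below all the higher thresholds, so
    these no longer act on it. *)
Lemma fold_stable c j n y : (forall i, (j <= i)%N -> c i < c i.+1) ->
  (j < n)%N ->
  fold_wave c n y = fold_wave c j.+1 y /\ fold_sign c n y = fold_sign c j.+1 y.
Proof.
move=> cc; elim: n => [//|n IH]; rewrite ltnS leq_eqVlt => /predU1P[<-//|jn].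
have [<- <-] := IH jn; case: n jn {IH} => [//|n] jn.
have lt : fold_wave c n.+1 y < c n.+1.
  by rewrite (le_lt_trans (fold_wave_le _ _ _))// cc.
set w := fold_wave c n.+1 y in lt *.
have -> : fold_wave c n.+2 y = Num.min w (2 * c n.+1 - w) by [].
have -> : fold_sign c n.+2 y =
  if w < c n.+1 then fold_sign c n.+1 y else - fold_sign c n.+1 y by [].
by rewrite lt; split => //; apply/min_idPl; lra.
Qed.

(** One reflection seen from two nearby states (g, c) and (g', c'): at a distance
    from the threshold both states are on the same side of it. A displacement of
    the threshold itself only enters on the reflected side, and there twice. *)
Lemma fold_step (g g' c c' s t h : R) : `|g' - g| <= h -> `|c' - c| <= h ->
  2 * h < `|g - c| ->
  let f (g c : R) := Num.min g (2 * c - g) in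
  let r (g c s : R) := if g < c then s else - s in
  r g' c' s = r g c s /\
  (g' - g = s * t ->
    f g' c' - f g c = r g c s * t + (if g < c then 0 else 2 * (c' - c))).
Proof.
rewrite !ler_norml => /andP[g1 g2] /andP[c1 c2] /=.
have h0 : 0 <= h by lra.
have [gc|gc] := ltP g c.
  rewrite ltr0_norm ?subr_lt0// => gch.
  have gc' : g' < c' by lra.
  by rewrite gc'; split => // st; rewrite !min_l; lra.
rewrite ger0_norm ?subr_ge0// => gch.
have gc' : c' <= g' by lra.
by rewrite ltNge gc'/=; split => // st; rewrite !min_r; lra.
Qed.

(** At a distance from the kinks, a small displacement of y does not change which
    reflections act. *)
Lemma fold_affine c n y y' h : `|y' - y| <= h -> h < `|y| ->
  (forall i, (i < n)%N -> 2 * h < `|fold_wave c i y - c i|) ->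
  fold_wave c n y' - fold_wave c n y = fold_sign c n y * (y' - y) /\
  fold_sign c n y' = fold_sign c n y.
Proof.
move=> yy' hy; elim: n => [_|n IH hc].
  move: yy'; rewrite ler_norml => /andP[y1 y2] /=.
  have [y0|y0] := ltP y 0.
    move: hy; rewrite ltr0_norm// => hy; have -> : y' < 0 by lra.
    by rewrite ltr0_norm ?mul1r; [split=> //; lra|lra].
  move: hy; rewrite ger0_norm// => hy; have -> : y' < 0 = false by apply/negbTE; lra.
  by rewrite ger0_norm; [split=> //; lra|lra].
have [|dg ds] := IH; first by move=> i /ltnW; exact: hc.
have h0 : 0 <= h by exact: le_trans yy'.
have gh : `|fold_wave c n y' - fold_wave c n y| <= h.
  by rewrite dg normrM; case: (fold_sign_pm1 c n y) => ->;
    rewrite ?normrN normr1 mul1r.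
have cc : `|c n - c n| <= h by rewrite subrr normr0.
have [rE fE] := fold_step (fold_sign c n y) (y' - y) gh cc (hc n (leqnn _)).
split; last by rewrite /= ds.
by have /= -> := fE dg; rewrite subrr mulr0 if_same addr0.
Qed.

Lemma fold_wave_lip c n y y' :
  `|fold_wave c n y' - fold_wave c n y| <= `|y' - y|.
Proof.
elim: n => [|n IH] /=.
  rewrite opprB addrC addrA addrNK distrC; exact: ler_dist_dist.
set g := fold_wave c n y in IH *; set g' := fold_wave c n y' in IH *.
move: IH; rewrite !ler_norml => /andP[h1 h2].
by have [|] := leP g (2 * c n - g); have [|] := leP g' (2 * c n - g'); lra.
Qed.

End Folding.

(** * The branching wave *)

Section Branching.
Context {R : realType}.
Variable m : nat.
Implicit Types (y d h : R) (i j n : nat).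

(** Half the height of the wave of period 2^-j: a reflection there halves the
    period. *)
Definition fold_level j : R := (2 ^+ j.+2)^-1.
Definition fold_slope j : R := 3 ^+ j.+1 / 3 ^+ m * fold_level j.
Definition layer_depth j : R := 3 ^+ m / 3 ^+ j.

(** At depth d below the lateral faces, generation j branches while d
    decreases from layer_depth j to layer_depth j.+1: its threshold sinks
    linearly, reaches fold_level j, and remains there up to the boundary.

    The thicknesses of the layers decrease with ratio 1/3 and the periods with
    ratio 1/2. As 1/3 lies strictly between 1/4 and 1/2, the elastic energy
    (slope squared times thickness, ratio 3/4) and the surface energy (thickness
    over period, ratio 2/3) of the layers are both geometric. *)
Definition threshold d j : R := Num.max (fold_level j) (fold_slope j * d).

Local Notation a := fold_level.
Local Notation b := fold_slope.
Local Notation del := layer_depth.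

Lemma fold_level_gt0 j : 0 < a j.
Proof. by rewrite invr_gt0 exprn_gt0. Qed.

Lemma fold_levelS j : a j = 2 * a j.+1.
Proof. by rewrite /fold_level [2 ^+ j.+3]exprS; field; rewrite expf_neq0. Qed.

Lemma fold_slope_gt0 j : 0 < b j.
Proof. by rewrite mulr_gt0 ?divr_gt0 ?exprn_gt0 ?fold_level_gt0. Qed.

Lemma fold_slopeS j : b j.+1 = 3 / 2 * b j.
Proof.
by rewrite /fold_slope [a j]fold_levelS [3 ^+ j.+2]exprS; field; rewrite expf_neq0.
Qed.

Lemma layer_depth_gt0 j : 0 < del j.
Proof. by rewrite divr_gt0 ?exprn_gt0. Qed.

Lemma layer_depthS j : del j = 3 * del j.+1.
Proof. by rewrite /layer_depth exprS; field; rewrite !expf_neq0. Qed.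

Lemma layer_depth_mono i j : (i <= j)%N -> del j <= del i.
Proof.
move=> /subnK <-; elim: (j - i)%N => [//|k]; apply: le_trans.
by rewrite addSn [leRHS]layer_depthS; have := layer_depth_gt0 (k + i).+1; lra.
Qed.

Lemma fold_slope_mono i j : (i <= j)%N -> b i <= b j.
Proof.
move=> /subnK <-; elim: (j - i)%N => [//|k] /le_trans; apply.
by rewrite addSn fold_slopeS; have := fold_slope_gt0 (k + i); lra.
Qed.

Lemma slope_depth j : b j * del j.+1 = a j.
Proof. by rewrite /fold_slope /layer_depth; field; rewrite !expf_neq0. Qed.

Lemma threshold_lo j d : d <= del j.+1 -> threshold d j = a j.
Proof. by move=> dj; rewrite /threshold max_l// -slope_depth ler_pM2l// fold_slope_gt0. Qed.

Lemma threshold_hi j d : del j.+1 <= d -> threshold d j = b j * d.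
Proof. by move=> dj; rewrite /threshold max_r// -slope_depth ler_pM2l// fold_slope_gt0. Qed.

Lemma threshold_ge j d : a j <= threshold d j.
Proof. by rewrite /threshold le_max lexx. Qed.

Lemma threshold_halving j d : threshold d j <= 2 * threshold d j.+1.
Proof.
have [dj|/ltW dj] := leP d (del j.+1).
  by rewrite threshold_lo// fold_levelS; have := threshold_ge j.+1 d; lra.
have dj' : del j.+2 <= d by rewrite (le_trans _ dj)// layer_depth_mono.
rewrite !threshold_hi// fold_slopeS.
have := fold_slope_gt0 j; have := layer_depth_gt0 j.+1; nra.
Qed.

(** Beyond depth layer_depth j.+1 the later thresholds are too high to act: see
    fold_stable. *)
Lemma threshold_incr j d : del j.+1 <= d -> threshold d j < threshold d j.+1.
Proof.
move=> dj.
have dj' : del j.+2 <= d by rewrite (le_trans _ dj)// layer_depth_mono.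
rewrite !threshold_hi// fold_slopeS.
have := fold_slope_gt0 j; have := layer_depth_gt0 j.+1; nra.
Qed.

Lemma threshold_lip j d d' : b j <= 1 ->
  `|threshold d' j - threshold d j| <= `|d' - d|.
Proof.
move=> b1; rewrite /threshold; have b0 := fold_slope_gt0 j.
have := ler_norm (d' - d); have := ler_norm (- (d' - d)); rewrite normrN.
move: (`|d' - d|) => e e1 e2; rewrite ler_norml.
by have [|] := leP (a j) (b j * d); have [|] := leP (a j) (b j * d'); nra.
Qed.

Definition wave n y d := fold_wave (threshold d) n y.
Definition wave_sign n y d := fold_sign (threshold d) n y.

(** The wave at depths below layer_depth n, where its first n reflections are
    complete: see wave_tooth. *)
Definition tooth n y := fold_wave fold_level n y.

Lemma wave_tooth n y d : d <= del n ->
  wave n y d = tooth n y /\ wave_sign n y d = fold_sign fold_level n y.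
Proof.
move=> dn; apply: eq_fold => i i_n; apply: threshold_lo.
by rewrite (le_trans dn)// layer_depth_mono.
Qed.

Lemma wave_ge0 n y d : `|y| <= 2^-1 -> 0 <= wave n y d.
Proof.
move=> y2; apply: fold_wave_ge0 => //.
  by rewrite (le_trans _ (_ : 2 * a 0 <= _))// ?ler_pM2l ?threshold_ge// /fold_level; lra.
by move=> i _; exact: threshold_halving.
Qed.

(** A slope at most 1 of the last threshold keeps the wave below the depth, so
    that the cut-off by the depth in the profile acts in the bottom layer only. *)
Lemma wave_le n y d : (0 < n)%N -> b n.-1 <= 1 -> del n <= d -> 0 <= d ->
  wave n y d <= d.
Proof.
case: n => [//|n] _ /= b1 dn d0; rewrite (le_trans (fold_wave_le _ _ _))//.
by rewrite threshold_hi//; nra.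
Qed.

(** The places from which a step of length h may cross a kink: the ridge of the
    tent, the limits of the layers, and the reflection heights. *)
Definition near_kink n h y d : Prop :=
  [\/ `|y| <= h, exists2 j, (j <= n)%N & `|d - del j| <= h
    | exists j, [/\ (j < n)%N, d <= del j & `|tooth j y - threshold d j| <= 2 * h]].

Lemma far_tooth n h y d j : ~ near_kink n h y d -> (j < n)%N -> d <= del j ->
  2 * h < `|tooth j y - threshold d j|.
Proof.
move=> nb jn dj; rewrite ltNge; apply/negP => le; apply: nb.
by apply: Or33; exists j.
Qed.

Lemma far_depth n h y d d' j : ~ near_kink n h y d -> (j <= n)%N -> `|d' - d| <= h ->
  (d <= del j -> d' <= del j) /\ (del j <= d -> del j <= d').
Proof.
move=> nb jn dd'.
have : h < `|d - del j|.
  by rewrite ltNge; apply/negP => le; apply: nb; apply: Or32; exists j.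
move: dd'; rewrite ler_norml => /andP[d1 d2].
by have [|] := leP (del j) d => ?; [rewrite ger0_norm|rewrite ltr0_norm]; lra.
Qed.

Lemma layer_cases n d : d < del 0 ->
  d < del n \/ exists2 i, (i < n)%N & del i.+1 <= d < del i.
Proof.
move=> d0; elim: n => [|n IH]; first by left.
case: IH => [dn|[i i_n di]]; last by right; exists i => //; exact: leqW.
by have [dn'|dn'] := ltP d (del n.+1); [left|right; exists n => //; rewrite dn'].
Qed.

Section Increment.
Variables (n : nat) (h y y' d d' : R).
Hypotheses (b1 : forall i, (i < n)%N -> b i <= 1) (nb : ~ near_kink n h y d)
  (yy' : `|y' - y| <= h) (dd' : `|d' - d| <= h).

Lemma tooth_increment j : (j <= n)%N -> d <= del j ->
  [/\ wave j y d = tooth j y, wave j y' d' = tooth j y',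
      tooth j y' - tooth j y = wave_sign j y d * (y' - y)
    & wave_sign j y' d' = wave_sign j y d].
Proof.
move=> jn dj.
have [-> ->] := wave_tooth y dj.
have [-> ->] := wave_tooth y' ((far_depth nb jn dd').1 dj).
have [|||dt ds] := @fold_affine _ fold_level j y y' h => //.
  by rewrite ltNge; apply/negP => ?; apply: nb; exact: Or31.
move=> i ij; have dj' : d <= del i.+1 by rewrite (le_trans dj)// layer_depth_mono.
rewrite -(threshold_lo dj'); apply: (far_tooth nb); first exact: leq_trans jn.
by rewrite (le_trans dj)// layer_depth_mono// ltnW.
Qed.

(** In layer i the earlier reflections are complete and the later ones have not
    started, so only the i-th threshold sees the depth. The increment therefore
    differs from that of a function of slope +-1 in y by at most twice the
    displacement of that threshold. *)
Lemma wave_increment i : (i < n)%N -> del i.+1 <= d -> d <= del i ->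
  wave_sign n y' d' = wave_sign n y d /\
  `|wave n y' d' - wave n y d - wave_sign n y d * (y' - y)| <= 2 * b i * h.
Proof.
move=> i_n di di'.
have di1 := (far_depth nb i_n dd').2 di.
have stable z e : del i.+1 <= e ->
    wave n z e = wave i.+1 z e /\ wave_sign n z e = wave_sign i.+1 z e.
  move=> de; apply: fold_stable => // k ik; apply: threshold_incr.
  by rewrite (le_trans _ de)// layer_depth_mono.
have [-> ->] := stable y d di; have [-> ->] := stable y' d' di1.
have [wE wE' dt ds] := tooth_increment (ltnW i_n) di'.
have tb : 2 * h < `|wave i y d - threshold d i|.
  by rewrite wE; exact: (far_tooth nb).
have gh : `|wave i y' d' - wave i y d| <= h.
  rewrite wE wE' dt normrM; case: (fold_sign_pm1 (threshold d) i y);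
    by rewrite /wave_sign => ->; rewrite ?normrN normr1 mul1r.
have ch : `|threshold d' i - threshold d i| <= h.
  exact: le_trans (threshold_lip _ _ (b1 i_n)) dd'.
have [rE fE] := fold_step (wave_sign i y d) (y' - y) gh ch tb.
split.
  by rewrite /wave_sign /= in rE *; rewrite -rE -/(wave i y' d') -/(wave_sign i y' d') ds.
rewrite wE wE' in fE; have := fE dt; rewrite /wave /wave_sign /=.
rewrite -/(wave i y' d') -/(wave i y d) -/(wave_sign i y d) wE wE' => ->.
have b0 := fold_slope_gt0 i; have h0 : 0 <= h by exact: le_trans yy'.
rewrite addrAC subrr add0r; case: ifP => _; first by rewrite normr0; nra.
rewrite (threshold_hi di) (threshold_hi di1).
have -> : 2 * (b i * d' - b i * d) = 2 * b i * (d' - d) by ring.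
by rewrite normrM gtr0_norm ?ler_pM2l// mulr_gt0.
Qed.

Lemma wave_increment_bottom : d <= del n ->
  wave_sign n y' d' = wave_sign n y d /\ `|wave n y' d' - wave n y d| <= h.
Proof.
move=> dn; have [wE wE' dt ds] := tooth_increment (leqnn n) dn.
split=> //; rewrite wE wE'; exact: le_trans (fold_wave_lip _ _ _ _) yy'.
Qed.

End Increment.

End Branching.

(** * Affine changes of one coordinate *)

Section AffineLine.
Context {R : realType}.
Notation mu := (@lebesgue_measure R).
Notation T := (measurableTypeR R).

Lemma measurable_affine (k t : R) : measurable_fun [set: T] (fun x : T => k * x + t : T).
Proof. by apply: measurable_funD => //; exact: measurable_funM. Qed.

(** Lebesgue measure is determined by its values on intervals. *)
Lemma lebesgue_measure_affine (k t : R) (A : set T) : k != 0 -> measurable A ->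
  mu ((fun x : T => k * x + t : T) @^-1` A) = ((`|k|^-1)%:E * mu A)%E.
Proof.
move=> k0 mA; pose f : T -> T := fun x => k * x + t.
have mf : measurable_fun setT f by exact: measurable_affine.
have k_gt0 : 0 < `|k| by rewrite normr_gt0.
pose r : {nonneg R} := NngNum (normr_ge0 k).
suff : mu A = (`|k|%:E * mu (f @^-1` A))%E.
  by move=> ->; rewrite muleA -EFinM mulVf ?mul1e// gt_eqF.
have := @lebesgue_measure_unique R (mscale r (pushforward mu f) : {measure set T -> \bar R}).
apply => // _ [[a b]] _ <-.
change (mu `]a, b] = `|k|%:E * mu (f @^-1` `]a, b]))%E.
have [k_pos|k_neg] := ltP 0 k.
  have -> : f @^-1` `]a, b] = `](a - t) / k, (b - t) / k]%classic.
    apply/seteqP; split => x /=; rewrite !in_itv/= /f /=.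
      by rewrite ltr_pdivrMr// ler_pdivlMr// => /andP[? ?]; apply/andP; split; lra.
    by rewrite ltr_pdivrMr// ler_pdivlMr// => /andP[? ?]; apply/andP; split; lra.
  rewrite !lebesgue_measure_itv/= !lte_fin ltr_pM2r ?invr_gt0// ltrD2r.
  case: ifP => _; last by rewrite mule0.
  by rewrite -!EFinD -EFinM gtr0_norm//; congr _%:E; field.
have k_lt0 : k < 0 by rewrite lt_neqAle k0.
have -> : f @^-1` `]a, b] = `[(b - t) / k, (a - t) / k[%classic.
  apply/seteqP; split => x /=; rewrite !in_itv/= /f /=.
    by rewrite ler_ndivrMr// ltr_ndivlMr// => /andP[? ?]; apply/andP; split; lra.
  by rewrite ler_ndivrMr// ltr_ndivlMr// => /andP[? ?]; apply/andP; split; lra.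
rewrite !lebesgue_measure_itv/= !lte_fin ltr_nM2r ?invr_lt0// ltrD2r.
case: ifP => _; last by rewrite mule0.
by rewrite -!EFinD -EFinM ltr0_norm//; congr _%:E; field.
Qed.

End AffineLine.

Section FibrewiseMaps.
Context {d1 d2 : measure_display} {R : realType}.
Context {T1 : measurableType d1} {T2 : measurableType d2}.
Variable m1 : {sigma_finite_measure set T1 -> \bar R}.
Variable m2 : {sigma_finite_measure set T2 -> \bar R}.

Lemma product_measureE (A : set (T1 * T2)) : measurable A ->
  (m1 \x m2)%E A = (\int[m2]_y m1 (ysection A y))%E.
Proof.
move=> mA; rewrite (@product_measure_unique _ _ _ _ _ m1 m2 (m1 \x^ m2)%E)//.
by move=> *; exact: product_measure2E.
Qed.

(** Cavalieri: a map that acts within the fibres scales the measure as it does in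
    every fibre. *)
Lemma fibrewise_right (r : R) (psi : T1 -> T2 -> T2) (A : set (T1 * T2)) :
  (0 <= r) ->
  measurable_fun setT (fun p : T1 * T2 => psi p.1 p.2) ->
  (forall x B, measurable B -> m2 (psi x @^-1` B) = (r%:E * m2 B)%E) ->
  measurable A ->
  (m1 \x m2)%E ((fun p => (p.1, psi p.1 p.2)) @^-1` A) = (r%:E * (m1 \x m2) A)%E.
Proof.
move=> r0 mpsi psiE mA; rewrite /product_measure1 -ge0_integralZl//; last first.
  exact: measurable_fun_xsection.
apply: eq_integral => x _ /=; rewrite -(psiE x); last exact: measurable_xsection.
by congr (m2 _); rewrite !xsectionE.
Qed.

Lemma fibrewise_left (r : R) (psi : T2 -> T1 -> T1) (A : set (T1 * T2)) :
  (0 <= r) ->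
  measurable_fun setT (fun p : T1 * T2 => psi p.2 p.1) ->
  (forall x B, measurable B -> m1 (psi x @^-1` B) = (r%:E * m1 B)%E) ->
  measurable A ->
  (m1 \x m2)%E ((fun p => (psi p.2 p.1, p.2)) @^-1` A) = (r%:E * (m1 \x m2) A)%E.
Proof.
move=> r0 mpsi psiE mA; rewrite !product_measureE//; last first.
  by rewrite -[X in measurable X]setTI; apply: measurable_fun_pair mA.
rewrite -ge0_integralZl//; last exact: measurable_fun_ysection.
apply: eq_integral => x _ /=; rewrite -(psiE x); last exact: measurable_ysection.
by congr (m1 _); rewrite !ysectionE.
Qed.

End FibrewiseMaps.

Lemma measurable_fun2 d (R : realType) (X : measurableType d)
    (f : measurableTypeR R -> measurableTypeR R -> measurableTypeR R)
    (g h : X -> measurableTypeR R) :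
  measurable_fun setT (fun p : measurableTypeR R * measurableTypeR R => f p.1 p.2) ->
  measurable_fun setT g -> measurable_fun setT h ->
  measurable_fun setT (fun x => f (g x) (h x)).
Proof.
move=> mf mg mh; apply: (measurableT_comp mf (g := fun x => (g x, h x))).
exact: measurable_fun_pair.
Qed.

Section AffineSpace.
Context {R : realType}.
Notation mu := (@lebesgue_measure R).
Notation T := (measurableTypeR R).
Implicit Types (k : R) (A : set (coords3 R)).

Lemma affine_coord3 k (f : coords2 R -> T) A : k != 0 ->
  measurable_fun setT f -> measurable A ->
  lebesgue3 ((fun p : coords3 R => (p.1, k * p.2 + f p.1 : T)) @^-1` A) =
  ((`|k|^-1)%:E * lebesgue3 A)%E.
Proof.
move=> k0 mf mA.
apply: (@fibrewise_right _ _ _ _ _ (@lebesgue2 R) mu _ (fun x y => k * y + f x)) => //.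
- apply: measurable_funD; first exact: measurable_funM.
  exact: measurableT_comp.
- by move=> x B mB; exact: lebesgue_measure_affine.
Qed.

Lemma affine_coord2 k (f : T -> T -> T) A : k != 0 ->
  measurable_fun setT (fun p : T * T => f p.1 p.2) -> measurable A ->
  lebesgue3 ((fun p : coords3 R => ((p.1.1, k * p.1.2 + f p.1.1 p.2 : T), p.2)) @^-1` A) =
  ((`|k|^-1)%:E * lebesgue3 A)%E.
Proof.
move=> k0 mf mA.
apply: (@fibrewise_left _ _ _ _ _ (@lebesgue2 R) mu _
  (fun z x => (x.1, k * x.2 + f x.1 z : T))) => //.
- apply: measurable_fun_pair; first exact: measurableT_comp.
  apply: measurable_funD.
    by apply: measurable_funM => //; apply: measurableT_comp => //; exact: measurableT_comp.
  by apply: (measurable_fun2 mf) => //; exact: measurableT_comp.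
- move=> z B mB.
  apply: (@fibrewise_right _ _ _ _ _ mu mu _ (fun x y => k * y + f x z)) => //.
  + apply: measurable_funD; first exact: measurable_funM.
    exact: (measurable_fun2 mf).
  + by move=> x C mC; exact: lebesgue_measure_affine.
Qed.

Lemma affine_coord1 k (f : T -> T -> T) A : k != 0 ->
  measurable_fun setT (fun p : T * T => f p.1 p.2) -> measurable A ->
  lebesgue3 ((fun p : coords3 R => ((k * p.1.1 + f p.1.2 p.2 : T, p.1.2), p.2)) @^-1` A) =
  ((`|k|^-1)%:E * lebesgue3 A)%E.
Proof.
move=> k0 mf mA.
apply: (@fibrewise_left _ _ _ _ _ (@lebesgue2 R) mu _
  (fun z x => (k * x.1 + f x.2 z : T, x.2))) => //.
- apply: measurable_fun_pair; last exact: measurableT_comp.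
  apply: measurable_funD.
    by apply: measurable_funM => //; apply: measurableT_comp => //; exact: measurableT_comp.
  by apply: (measurable_fun2 mf) => //; exact: measurableT_comp.
- move=> z B mB.
  apply: (@fibrewise_left _ _ _ _ _ mu mu _ (fun x y => k * y + f x z)) => //.
  + apply: measurable_funD; first exact: measurable_funM.
    exact: (measurable_fun2 mf).
  + by move=> x C mC; exact: lebesgue_measure_affine.
Qed.

End AffineSpace.

(** * Translations and the rotation to the frame of the cube *)

(** The rotation to the frame (n, d, b32), with r2 and r3 for the square roots of
    2 and 3, as a product of three maps that change one coordinate each: s
    replaces the first one, t the second one, and the third one is then expressed
    by s, t and itself. The three factors -2/(r2 r3), r3/2 and r2 multiply to -1. *)
Lemma rotation_shears (R : realType) (r2 r3 a b c : R) :
  r2 ^+ 2 = 2 -> r3 ^+ 2 = 3 -> r2 != 0 -> r3 != 0 ->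
  let s := - 2 / (r2 * r3) * a + (b + c) / (r2 * r3) in
  let t := r3 / 2 * b + (3 / 2 * c - r2 * r3 / 2 * s) / r3 in
  [/\ (r2 * r3)^-1 * (- 2 * a + b + c) = s, r3^-1 * (a + b + c) = t
    & r2^-1 * (c - b) = r2 * c - (2 / 3 * (r3 * t + r2 * r3 / 2 * s)) / r2].
Proof.
move=> s2 s3 n2 n3 s t.
have sE : r2 * r3 * s = -2 * a + b + c by rewrite /s; field; rewrite n3 n2.
have tE : r3 * t = a + b + c.
  have -> : r3 * t = r3 ^+ 2 / 2 * b + (3 / 2 * c - r2 * r3 * s / 2) by rewrite /t; field.
  by rewrite sE s3; field.
split.
- by rewrite -sE mulKf// mulf_neq0.
- by rewrite -tE mulKf.
- apply: (mulfI n2); rewrite mulVKf// mulrBr mulrA -expr2 s2 tE mulrCA divff// mulr1.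
  have -> : r2 * r3 / 2 * s = r2 * r3 * s / 2 by ring.
  by rewrite sE; field.
Qed.

Section Coordinates.
Context {R : realType}.
Notation T := (measurableTypeR R).
Notation mu := (@lebesgue_measure R).
Implicit Types (a b c k : R) (x y v : 'cV[R]_3) (p : coords3 R).

Lemma forall_I3 (P : 'I_3 -> Prop) : P 0 -> P 1 -> P 2 -> forall i, P i.
Proof.
move=> P0 P1 P2 [[|[|[|//]]] i3].
- by rewrite (_ : Ordinal i3 = 0)//; exact/val_inj.
- by rewrite (_ : Ordinal i3 = 1)//; exact/val_inj.
- by rewrite (_ : Ordinal i3 = 2)//; exact/val_inj.
Qed.

Lemma sum_I3 (V : nmodType) (F : 'I_3 -> V) : \sum_i F i = F 0 + F 1 + F 2.
Proof.
rewrite !big_ord_recr big_ord0 /= add0r; congr (F _ + F _ + F _); exact/val_inj.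
Qed.

Lemma vec3E a b c : (vec3 a b c 0 0 = a) * (vec3 a b c 1 0 = b) * (vec3 a b c 2 0 = c).
Proof. by rewrite !mxE. Qed.

Lemma dotE x y : dot x y = x 0 0 * y 0 0 + x 1 0 * y 1 0 + x 2 0 * y 2 0.
Proof. exact: sum_I3. Qed.

Lemma dotDl x y v : dot (x + y) v = dot x v + dot y v.
Proof. by rewrite !dotE !mxE; ring. Qed.

Lemma dotZl k x v : dot (k *: x) v = k * dot x v.
Proof. by rewrite !dotE !mxE; ring. Qed.

Lemma norm_cV_le x (M : R) : (forall i, `|x i 0| <= M) -> `|x| <= M.
Proof.
move=> h; have M0 : 0 <= M by exact: le_trans (h 0).
rewrite [leLHS]/Num.Def.normr/= mx_normrE (bigmax_le _ M0)//= => -[i j] _.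
by rewrite ord1.
Qed.

Lemma entry_le_norm x i : `|x i 0| <= `|x|.
Proof.
rewrite [leRHS]/Num.Def.normr/= mx_normrE; apply/bigmax_geP; right => /=.
by exists (i, 0).
Qed.

Lemma of_coordsE p : (of_coords p 0 0 = p.1.1) * (of_coords p 1 0 = p.1.2) *
  (of_coords p 2 0 = p.2).
Proof. by rewrite !vec3E. Qed.

Lemma measurable_coord1 : measurable_fun setT (fun p : coords3 R => p.1.1).
Proof. exact: (measurableT_comp measurable_fst measurable_fst). Qed.
Lemma measurable_coord2 : measurable_fun setT (fun p : coords3 R => p.1.2).
Proof. exact: (measurableT_comp measurable_snd measurable_fst). Qed.
Lemma measurable_coord3 : measurable_fun setT (fun p : coords3 R => p.2).
Proof. exact: measurable_snd. Qed.

Lemma measurable3_dot v : measurable3 setT (fun x => dot x v).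
Proof.
have -> : (fun x => dot x v) =
    (fun x => x 0 0 * v 0 0 + x 1 0 * v 1 0 + x 2 0 * v 2 0).
  by apply/funext => x; exact: dotE.
rewrite /measurable3 /comp; under eq_fun do rewrite !of_coordsE.
apply: measurable_funD; first apply: measurable_funD.
- exact: measurable_funM measurable_coord1 (measurable_cst _).
- exact: measurable_funM measurable_coord2 (measurable_cst _).
- exact: measurable_funM measurable_coord3 (measurable_cst _).
Qed.

Definition translate v p : coords3 R :=
  ((p.1.1 + v 0 0, p.1.2 + v 1 0), p.2 + v 2 0).

Lemma of_coords_translate v p : of_coords (translate v p) = of_coords p + v.
Proof. by apply/colP; elim/forall_I3; rewrite of_coordsE mxE of_coordsE. Qed.

Lemma measurable_translate v : measurable_fun setT (translate v).
Proof.
apply: measurable_fun_pair; first apply: measurable_fun_pair.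
- exact: measurable_funD measurable_coord1 (measurable_cst _).
- exact: measurable_funD measurable_coord2 (measurable_cst _).
- exact: measurable_funD measurable_coord3 (measurable_cst _).
Qed.

Lemma lebesgue3_translate v (A : set (coords3 R)) : measurable A ->
  lebesgue3 (translate v @^-1` A) = lebesgue3 A.
Proof.
move=> mA.
pose A1 := (fun p : coords3 R => ((1 * p.1.1 + v 0 0 : T, p.1.2), p.2)) @^-1` A.
pose A2 := (fun p : coords3 R => ((p.1.1, 1 * p.1.2 + v 1 0 : T), p.2)) @^-1` A1.
have mA1 : measurable A1.
  rewrite -[X in measurable X]setTI; apply: (_ : measurable_fun setT _) => //.
  apply: measurable_fun_pair => //; apply: measurable_fun_pair.
    apply: measurable_funD => //; exact: measurable_funM (measurable_cst _) measurable_coord1.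
  exact: measurable_coord2.
have mA2 : measurable A2.
  rewrite -[X in measurable X]setTI; apply: (_ : measurable_fun setT _) => //.
  apply: measurable_fun_pair => //; apply: measurable_fun_pair.
    exact: measurable_coord1.
  apply: measurable_funD => //; exact: measurable_funM (measurable_cst _) measurable_coord2.
have -> : translate v @^-1` A =
    (fun p : coords3 R => (p.1, 1 * p.2 + v 2 0 : T)) @^-1` A2.
  apply/funext => p; rewrite /A2 /A1 /translate /preimage /=.
  by rewrite !mul1r.
have one0 : (1 : R) != 0 by exact: oner_neq0.
rewrite (affine_coord3 (f := fun=> v 2 0))//.
rewrite (affine_coord2 (f := fun _ _ => v 1 0))//.
rewrite (affine_coord1 (f := fun _ _ => v 0 0))//.
by rewrite normr1 invr1 !mul1e.
Qed.

Definition rotate p : coords3 R :=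
  let x := of_coords p in ((dot x (vn R), dot x (vd R)), dot x (vb32 R)).

Lemma measurable_rotate : measurable_fun setT rotate.
Proof.
by apply: measurable_fun_pair; first apply: measurable_fun_pair;
  exact: measurable3_dot.
Qed.

Lemma dot_vn x : dot x (vn R) = (Num.sqrt 6)^-1 * (-2 * x 0 0 + x 1 0 + x 2 0).
Proof. by rewrite dotE !mxE /=; ring. Qed.
Lemma dot_vd x : dot x (vd R) = (Num.sqrt 3)^-1 * (x 0 0 + x 1 0 + x 2 0).
Proof. by rewrite dotE !mxE /=; ring. Qed.
Lemma dot_vb32 x : dot x (vb32 R) = (Num.sqrt 2)^-1 * (x 2 0 - x 1 0).
Proof. by rewrite dotE !mxE /=; ring. Qed.

Lemma lebesgue3_rotate (A : set (coords3 R)) : measurable A ->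
  lebesgue3 (rotate @^-1` A) = lebesgue3 A.
Proof.
move=> mA; set r2 := Num.sqrt (2 : R); set r3 := Num.sqrt (3 : R).
have s2 : r2 ^+ 2 = 2 by rewrite sqr_sqrtr.
have s3 : r3 ^+ 2 = 3 by rewrite sqr_sqrtr.
have r2p : 0 < r2 by rewrite sqrtr_gt0.
have r3p : 0 < r3 by rewrite sqrtr_gt0.
have r6 : Num.sqrt (6 : R) = r2 * r3 by rewrite -sqrtrM// -natrM.
have e2 : Num.sqrt 2 = r2 by [].
have e3 : Num.sqrt 3 = r3 by [].
clearbody r2 r3.
have r2n : r2 != 0 by rewrite gt_eqF.
have r3n : r3 != 0 by rewrite gt_eqF.
pose k1 := - 2 / (r2 * r3); pose f1 (b c : T) : T := (b + c) / (r2 * r3).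
pose k2 := r3 / 2; pose f2 (s c : T) : T := (3 / 2 * c - r2 * r3 / 2 * s) / r3.
pose k3 := r2; pose f3 (q : coords2 R) : T :=
  - (2 / 3 * (r3 * q.2 + r2 * r3 / 2 * q.1) / r2).
pose M1 := fun p : coords3 R => ((k1 * p.1.1 + f1 p.1.2 p.2 : T, p.1.2), p.2).
pose M2 := fun p : coords3 R => ((p.1.1, k2 * p.1.2 + f2 p.1.1 p.2 : T), p.2).
pose M3 := fun p : coords3 R => (p.1, k3 * p.2 + f3 p.1 : T).
have mf1 : measurable_fun setT (fun p : T * T => f1 p.1 p.2).
  apply: measurable_funM => //; exact: measurable_funD.
have mf2 : measurable_fun setT (fun p : T * T => f2 p.1 p.2).
  apply: measurable_funM => //; apply: measurable_funB; exact: measurable_funM.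
have mf3 : measurable_fun setT f3.
  apply: measurable_funN; apply: measurable_funM => //; apply: measurable_funM => //.
  apply: measurable_funD; exact: measurable_funM.
have mM3 : measurable_fun setT M3.
  apply: measurable_fun_pair => //; apply: measurable_funD; first exact: measurable_funM.
  exact: measurableT_comp.
have mM2 : measurable_fun setT M2.
  apply: measurable_fun_pair => //; apply: measurable_fun_pair; first exact: measurable_coord1.
  apply: measurable_funD.
    exact: measurable_funM (measurable_cst _) measurable_coord2.
  exact: (measurable_fun2 mf2 measurable_coord1).
have mA3 : measurable (M3 @^-1` A) by rewrite -[X in measurable X]setTI; exact: mM3.
have mA2 : measurable (M2 @^-1` (M3 @^-1` A)).
  by rewrite -[X in measurable X]setTI; exact: mM2.
have -> : rotate @^-1` A = M1 @^-1` (M2 @^-1` (M3 @^-1` A)).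
  have -> // : rotate = M3 \o (M2 \o M1).
  apply/funext => -[[a b] c].
  rewrite /rotate /M1 /M2 /M3 /= dot_vn dot_vd dot_vb32 !of_coordsE /=.
  rewrite /k1 /k2 /k3 /f1 /f2 /f3 r6 e2 e3 /=.
  by have [-> -> ->] := rotation_shears a b c s2 s3 r2n r3n.
have k1n : k1 != 0 by rewrite mulf_neq0 ?oppr_eq0 ?invr_eq0 ?mulf_neq0// pnatr_eq0.
have k2n : k2 != 0 by rewrite mulf_neq0.
rewrite (affine_coord1 (f := f1))// (affine_coord2 (f := f2))// (affine_coord3 (f := f3))//.
rewrite !muleA -!EFinM.
have -> : `|k1|^-1 * `|k2|^-1 * `|k3|^-1 = 1.
  rewrite -!invfM -!normrM (_ : k1 * k2 * k3 = -1) ?normrN ?normr1 ?invr1//.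
  by rewrite /k1 /k2 /k3; field; rewrite r3n r2n.
by rewrite mul1e.
Qed.

End Coordinates.

(** * Measurable sets and integrable functions on R^3 *)

Section Integrals.
Context {R : realType}.
Notation T := (measurableTypeR R).
Notation mu := (@lebesgue_measure R).
Implicit Types (x y v : 'cV[R]_3) (p : coords3 R) (f g : 'cV[R]_3 -> R) (M : R).

Definition measurable_set3 (A : set 'cV[R]_3) := measurable (@of_coords R @^-1` A).

Lemma measurable3P (P : 'cV[R]_3 -> bool) :
  measurable_fun setT (P \o @of_coords R) -> measurable_set3 [set x | P x].
Proof.
by move=> /(_ measurableT [set true]); rewrite setTI; apply.
Qed.

(** An open set is the union of the cubes with rational centre and radius 1/(n+1)
    that it contains, and these are products of intervals in the coordinates. *)
Lemma open_measurable3 (U : set 'cV[R]_3) : open U -> measurable_set3 U.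
Proof.
move=> oU.
pose q_ (i : rat * rat * rat) : 'cV[R]_3 := vec3 (ratr i.1.1) (ratr i.1.2) (ratr i.2).
pose F (i : rat * rat * rat * nat) : set 'cV[R]_3 :=
  [set x | (ball (q_ i.1) i.2.+1%:R^-1 `<=` U) /\ forall j, `|q_ i.1 j 0 - x j 0| <
    i.2.+1%:R^-1].
have -> : U = \bigcup_i F i.
  apply/seteqP; split=> [x Ux|x [[i n] _ [/= qU xq]]]; last first.
    by apply: qU; split => // k l; rewrite ord1; exact: xq.
  have /nbhs_ballP[e /= e0 xeU] := open_nbhs_nbhs (conj oU Ux).
  have [n _ /(_ n (leqnn _)) /= ne] := near_infty_natSinv_lt (PosNum (divr_gt0 e0 (ltr0n R 2))).
  have n0 : 0 < n.+1%:R^-1 :> R by [].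
  have near_rat (a : R) : exists q : rat, `|ratr q - a| < n.+1%:R^-1.
    have [|q] := @rat_in_itvoo R (a - n.+1%:R^-1) (a + n.+1%:R^-1).
      by rewrite ltrD2l gtrN.
    rewrite in_itv /= => /andP[q1 q2]; exists q.
    by rewrite ltr_norml ltrBDr ltrBlDr addrC q1 addrC q2.
  have [q1 h1] := near_rat (x 0 0); have [q2 h2] := near_rat (x 1 0).
  have [q3 h3] := near_rat (x 2 0).
  exists (q1, q2, q3, n) => //; split=> [z [_ /= qz]|]; last first.
    by elim/forall_I3; rewrite !vec3E.
  apply: xeU; split=> // k l; rewrite ord1 {l}; rewrite /ball/=.
  have hk : `|q_ (q1, q2, q3) k 0 - x k 0| < n.+1%:R^-1.
    by elim/forall_I3: k; rewrite !vec3E.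
  have := qz k 0; rewrite /ball/= => hz.
  have -> : x k 0 - z k 0 = - (q_ (q1, q2, q3) k 0 - x k 0) + (q_ (q1, q2, q3) k 0 - z k
    0) by ring.
  rewrite (le_lt_trans (ler_normD _ _))// normrN (lt_trans (ltrD hk hz))//.
  by rewrite [ltRHS]splitr ltrD.
rewrite /measurable_set3 preimage_bigcup.
apply: countable_bigcupT_measurable; first exact: countableP.
move=> [i n]; rewrite /F /=.
have [qU|nU] := pselect (ball (q_ i) n.+1%:R^-1 `<=` U); last first.
  by rewrite (_ : _ @^-1` _ = set0)//; apply/seteqP; split => x //= -[].
rewrite (_ : _ @^-1` _ = [set p : coords3 R | (`|p.1.1 - ratr i.1.1| < n.+1%:R^-1)
   && (`|p.1.2 - ratr i.1.2| < n.+1%:R^-1) && (`|p.2 - ratr i.2| < n.+1%:R^-1)]); last first.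
  apply/seteqP; split=> [p [_ h]|p /= /andP[/andP[h1 h2] h3]].
    by have := h 0; have := h 1; have := h 2; rewrite !vec3E /= => h2 h1 h0;
     rewrite distrC h0 distrC h1 distrC h2.
  by split=> //; elim/forall_I3; rewrite !vec3E distrC.
rewrite -[X in measurable X]setTI.
suff mP : measurable_fun setT (fun p : coords3 R => (`|p.1.1 - ratr i.1.1| < n.+1%:R^-1)
   && (`|p.1.2 - ratr i.1.2| < n.+1%:R^-1) && (`|p.2 - ratr i.2| < n.+1%:R^-1)) by exact: mP.
have mball (h : coords3 R -> T) (a : R) : measurable_fun setT h ->
    measurable_fun setT (fun p => `|h p - a| < n.+1%:R^-1).
  move=> mh; apply: measurable_fun_ltr => //.
  by apply: measurableT_comp => //; exact: measurable_funB.
apply: measurable_and; first apply: measurable_and.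
- exact: (mball _ _ (@measurable_coord1 R)).
- exact: (mball _ _ (@measurable_coord2 R)).
- exact: (mball _ _ (@measurable_coord3 R)).
Qed.

Lemma continuous_measurable3 f : continuous f -> measurable3 setT f.
Proof.
move=> cf; rewrite /measurable3 preimage_setT.
apply: (measurability _ (RGenOpens.measurableE R)) => _ [_ [a [b ->] <-]].
rewrite setTI comp_preimage; apply: open_measurable3.
by move/continuousP : cf; apply; exact: interval_open.
Qed.

Lemma closed_measurable3 (A : set 'cV[R]_3) : closed A -> measurable_set3 A.
Proof.
move=> /closed_openC/open_measurable3; rewrite /measurable_set3 preimage_setC.
by move=> /measurableC; rewrite setCK.
Qed.

Lemma compact_measurable3 (A : set 'cV[R]_3) : compact A -> measurable_set3 A.
Proof. by move=> /compact_closed-/(_ (@norm_hausdorff _ _))/closed_measurable3. Qed.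

Definition box M : set 'cV[R]_3 := [set x | `|x| <= M].

Lemma box_coords M : @of_coords R @^-1` box M = (`[-M, M] `*` `[-M, M]) `*` `[-M, M].
Proof.
apply/seteqP; split=> [p /= pM|p [[/=]]]; rewrite ?in_itv /=.
  by split; first split => /=; rewrite ?in_itv/= -?ler_norml (le_trans _ pM)//;
    [rewrite -(of_coordsE p).1.1|rewrite -(of_coordsE p).1.2|rewrite -(of_coordsE p).2];
    exact: entry_le_norm.
by rewrite -!ler_norml => h1 h2 h3; apply: norm_cV_le; elim/forall_I3; rewrite of_coordsE.
Qed.

Lemma measurable_box M : measurable_set3 (box M).
Proof. by rewrite /measurable_set3 box_coords; apply: measurableX => //; exact:
  measurableX. Qed.

Lemma lebesgue2X (A B : set T) : measurable A -> measurable B ->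
  lebesgue2 (A `*` B) = (mu A * mu B)%E.
Proof. exact: product_measure1E. Qed.

Lemma lebesgue3X (A : set (coords2 R)) (B : set T) : measurable A -> measurable B ->
  lebesgue3 (A `*` B) = (lebesgue2 A * mu B)%E.
Proof. exact: product_measure1E. Qed.

Lemma lebesgue3_box M : (lebesgue3 (@of_coords R @^-1` box M) < +oo)%E.
Proof.
rewrite box_coords lebesgue3X//; last exact: measurableX.
by rewrite lebesgue2X// !lebesgue_measure_itv/=; case: ifP => _; rewrite -?EFinB -?EFinM
  ?mule0 ?ltry.
Qed.

Lemma bounded_box_integrable f M (B : R) : measurable3 setT f ->
  (forall x, `|f x| <= B) -> (forall x, M < `|x| -> f x = 0) ->
  integrable3 setT f.
Proof.
move=> mf fB f0; rewrite /integrable3 preimage_setT.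
have -> : EFin \o f \o @of_coords R = (EFin \o (f \o @of_coords R)) \_ (@of_coords R
  @^-1` box M).
  apply/funext => p; rewrite patchE /=; case: ifPn => //; rewrite notin_setE /= => /negP.
  by rewrite -ltNge => /f0 ->.
apply/(integrable_mkcond _ (measurable_box M)).1.
apply: measurable_bounded_integrable.
- exact: measurable_box.
- exact: lebesgue3_box.
- exact: measurable_funTS.
- by exists B; split; [exact: num_real|move=> C BC p _ /=; rewrite (le_trans (fB _))// ltW].
Qed.

End Integrals.

(** * Difference quotients *)

Lemma measure_preserving_integral d (X : measurableType d) (R : realType)
    (mu : {measure set X -> \bar R}) (phi : X -> X) (f : X -> \bar R) :
  measurable_fun setT phi -> measurable_fun setT f ->
  (forall A, measurable A -> mu (phi @^-1` A) = mu A) ->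
  mu.-integrable setT f ->
  (\int[mu]_(x in setT) f x = \int[mu]_(x in setT) (f \o phi) x)%E /\
  mu.-integrable setT (f \o phi).
Proof.
move=> mphi mf muE intf.
have pushE (g : X -> \bar R) : (\int[mu]_(x in setT) g x = \int[pushforward mu phi]_(x in
  setT) g x)%E.
  by apply: eq_measure_integral => A mA _; exact/esym/muE.
have intfphi : mu.-integrable (phi @^-1` setT) (f \o phi).
  move: intf => /integrableP[_ intf]; rewrite preimage_setT.
  apply/integrableP; split; first exact: measurableT_comp.
  rewrite (pushE (fun x => `|f x|)%E) ge0_integral_pushforward// in intf; exact:
    measurableT_comp.
by rewrite pushE integral_pushforward.
Qed.

Section DifferenceQuotients.
Context {R : realType}.
Notation T := (measurableTypeR R).
Implicit Types (x y v : 'cV[R]_3) (p : coords3 R) (f g phi : 'cV[R]_3 -> R) (M : R).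

Lemma integral3_translate v f : measurable3 setT f -> integrable3 setT f ->
  integral3 setT (fun x => f (x + v)) = integral3 setT f.
Proof.
move=> mf intf; rewrite /integral3 !preimage_setT.
rewrite /measurable3 preimage_setT in mf; rewrite /integrable3 preimage_setT in intf.
have [-> _] := measure_preserving_integral (measurable_translate v)
  ((measurable_EFinP _ _).2 mf) (@lebesgue3_translate R v) intf.
by apply: eq_integral => p _ /=; rewrite of_coords_translate.
Qed.

Lemma pderiv_off_support phi j x : ~ closure [set y | phi y != 0] x ->
  pderiv j phi x = 0.
Proof.
move=> nx.
have phi0 : \forall y \near x, phi y = 0.
  have : open (~` closure [set y | phi y != 0]) by exact/closed_openC/closed_closure.
  rewrite openE => /(_ _ nx); apply: filterS => y ny.
  by apply: contrapT => /eqP yn; apply: ny; exact: subset_closure.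
rewrite /pderiv (@near_eq_derive _ _ _ phi (cst 0)); first exact: derive_cst.
exact: phi0.
Qed.

Lemma C1c_bounds phi : C1c setT phi -> exists M B : R, [/\ 0 <= M, 0 <= B,
  forall x, M < `|x| -> phi x = 0 /\ forall j, pderiv j phi x = 0,
  forall x, `|phi x| <= B & forall j x, `|pderiv j phi x| <= B].
Proof.
move=> [cphi dphi cd cK _]; set K := closure _ in cK.
have bounded_on (g : 'cV[R]_3 -> R) : continuous g ->
    exists2 B, 0 <= B & forall x, K x -> `|g x| <= B.
  move=> cg; have cgK : compact (g @` K).
    by apply: continuous_compact => //; exact: continuous_subspaceT.
  have [B [_ hB]] := compact_bounded cgK; exists (`|B| + 1) => [|x Kx].
    by rewrite addr_ge0.
  by apply: (hB (`|B| + 1)) => /=; [rewrite ltr_pwDr// ler_norm|exists x].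
have [M0 [_ hM0]] := compact_bounded cK.
have nK x : `|M0| + 1 < `|x| -> ~ K x.
  move=> xM Kx; have : M0 < `|M0| + 1 by rewrite ltr_pwDr// ler_norm.
  by move=> /hM0/(_ x Kx); rewrite /= leNgt xM.
have off x : ~ K x -> phi x = 0.
  move=> nx; apply: contrapT => /eqP yn; apply: nx; exact: subset_closure.
have [B0 B00 hB0] := bounded_on _ cphi.
have [B1 B10 hB1] := bounded_on _ (cd 0).
have [B2 B20 hB2] := bounded_on _ (cd 1).
have [B3 B30 hB3] := bounded_on _ (cd 2).
exists (`|M0| + 1), (B0 + B1 + B2 + B3); split.
- by rewrite addr_ge0.
- by rewrite !addr_ge0.
- by move=> x /nK nx; split=> [|j]; [exact: off|exact: pderiv_off_support].
- move=> x; have [Kx|nx] := pselect (K x); first by have := hB0 x Kx; lra.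
  by rewrite off// normr0 !addr_ge0.
- move=> j x; have [Kx|nx] := pselect (K x); last first.
    by rewrite pderiv_off_support// normr0 !addr_ge0.
  by elim/forall_I3: j; [have := hB1 x Kx|have := hB2 x Kx|have := hB3 x Kx]; lra.
Qed.

Notation e_ j := (delta_mx j 0 : 'cV[R]_3).

Lemma is_derive_line phi j x (r : R) : derivable phi (x + r *: e_ j) (e_ j) ->
  is_derive r 1 (fun r : R => phi (x + r *: e_ j)) (pderiv j phi (x + r *: e_ j)).
Proof.
move=> d.
have E : (fun h : R => h^-1 *: (((fun r : R => phi (x + r *: e_ j)) \o shift r) (h *: 1)
  - phi (x + r *: e_ j)))
   = (fun h : R => h^-1 *: ((phi \o shift (x + r *: e_ j)) (h *: e_ j) - phi (x + r *: e_ j))).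
  apply/funext => h /=; congr (_ *: (phi _ - _)).
  by rewrite [h *: 1]mulr1 scalerDl addrCA.
apply: DeriveDef; first by rewrite /derivable E.
by rewrite /pderiv /derive E.
Qed.

Lemma norm_delta j : `|e_ j| <= 1.
Proof. by apply: norm_cV_le => i; rewrite mxE eqxx andbT; case: eqP; rewrite ?normr1
  ?normr0. Qed.

Lemma C1c_quotient_bound phi j B x (h : R) : C1c setT phi -> 0 < h ->
  (forall x, `|pderiv j phi x| <= B) -> `|phi x - phi (x - h *: e_ j)| <= B * h.
Proof.
move=> [cphi dphi _ _ _] h0 hB.
have lineE (r : R) : is_derive r 1 (fun r : R => phi ((x - h *: e_ j) + r *: e_ j))
  (pderiv j phi ((x - h *: e_ j) + r *: e_ j)).
  exact: is_derive_line.
have [|c _] := @MVT R (fun r : R => phi ((x - h *: e_ j) + r *: e_ j)) (fun r => pderiv j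
  phi ((x - h *: e_ j) + r *: e_ j)) 0 h h0.
apply: continuous_subspaceT => r; apply: differentiable_continuous.
  by apply/derivable1_diffP; exact: ex_derive.
rewrite scale0r addr0 addrNK subr0 => ->.
by rewrite normrM (gtr0_norm h0) ler_pM2r.
Qed.

Lemma C1c_quotient_cvg phi j x : C1c setT phi ->
  (fun k => k.+1%:R * (phi x - phi (x - k.+1%:R^-1 *: e_ j))) @ \oo --> pderiv j phi x.
Proof.
move=> [_ dphi _ _ _].
have dl : (fun h : R => h^-1 *: ((phi \o shift x) (h *: e_ j) - phi x)) @ 0^' --> pderiv
  j phi x.
  exact: dphi.
have hk : (fun k => - (k.+1%:R^-1) : R) @ \oo --> (0 : R)^'.
  move=> A /= [e /= e0 eA].
  apply: (filterS _ (near_infty_natSinv_lt (PosNum e0))) => k /= ke; apply: eA => /=.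
    by rewrite sub0r opprK ger0_norm.
  by rewrite oppr_eq0 invr_eq0.
have := cvg_comp _ _ hk dl; apply: cvg_trans; apply: near_eq_cvg; near=> k => /=.
rewrite invrN invrK scaleNr scaleNr -scalerN opprB; congr (_ * (_ - phi _)).
by rewrite addrC.
Unshelve. all: by end_near. Qed.

End DifferenceQuotients.

Section IBP.
Context {R : realType}.
Notation T := (measurableTypeR R).
Implicit Types (x y v : 'cV[R]_3) (p : coords3 R) (f g phi : 'cV[R]_3 -> R) (M : R).
Notation e_ j := (delta_mx j 0 : 'cV[R]_3).

Lemma measurable3_translate f v : measurable3 setT f -> measurable3 setT (fun x => f (x + v)).
Proof.
rewrite /measurable3 preimage_setT => mf.
rewrite (_ : _ \o _ = (f \o @of_coords R) \o translate v); last first.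
  by apply/funext => p /=; rewrite of_coords_translate.
apply: measurableT_comp => //; exact: measurable_translate.
Qed.

Lemma measurable3M f g : measurable3 setT f -> measurable3 setT g ->
  measurable3 setT (fun x => f x * g x).
Proof. by move=> mf mg; apply: measurable_funM. Qed.

Lemma measurable3B f g : measurable3 setT f -> measurable3 setT g ->
  measurable3 setT (fun x => f x - g x).
Proof. by move=> mf mg; apply: measurable_funB. Qed.

Lemma measurable3_cst (r : R) : measurable3 setT (cst r).
Proof. exact: measurable_cst. Qed.

Lemma integral3B f g : integrable3 setT f -> integrable3 setT g ->
  integral3 setT (fun x => f x - g x) = (integral3 setT f - integral3 setT g)%E.
Proof.
rewrite /integrable3 /integral3 !preimage_setT => intf intg.
by rewrite -integralB//; apply: eq_integral => p _; rewrite EFinB.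
Qed.

Lemma box_indic_integrable (c M : R) :
  (@lebesgue3 R).-integrable setT (fun p => (c * \1_(@of_coords R @^-1` box M) p)%:E).
Proof.
have := @bounded_box_integrable R (fun x => c * \1_(box M) x) M `|c|.
rewrite /integrable3 preimage_setT; apply.
- rewrite /measurable3 preimage_setT; apply: (@measurable_funM _ _ _ setT (cst c)
  (\1_(@of_coords R @^-1` box M))) => //.
  by apply: measurable_indic; exact: measurable_box.
- by move=> x; rewrite normrM indicE; case: (_ \in _); rewrite ?normr1 ?normr0 ?mulr1 ?mulr0.
- by move=> x; rewrite ltNge => /negP nx; rewrite indicE memNset ?mulr0.
Qed.

Definition locally_bounded f := forall M, exists B, forall x, `|x| <= M -> `|f x| <= B.

Lemma box_product_integrable f g M (B : R) : measurable3 setT f -> measurable3 setT g ->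
  locally_bounded f -> (forall x, `|g x| <= B) -> (forall x, M < `|x| -> g x = 0) ->
  integrable3 setT (fun x => f x * g x).
Proof.
move=> mf mg bf gB g0; have [Bf hBf] := bf M.
apply: (@bounded_box_integrable _ _ M (`|Bf| * B)); first exact: measurable3M.
  move=> x; have [xM|xM] := leP `|x| M; last first.
    by rewrite g0// mulr0 normr0 mulr_ge0// (le_trans _ (gB x)).
  by rewrite normrM ler_pM// (le_trans (hBf x xM))// ler_norm.
by move=> x /g0 ->; rewrite mulr0.
Qed.

Lemma locally_bounded_translate f v : locally_bounded f -> locally_bounded (fun x => f (x + v)).
Proof.
move=> bf M; have [B hB] := bf (M + `|v|); exists B => x xM; apply: hB.
by rewrite (le_trans (ler_normD _ _))// lerD2r.
Qed.

(** Translation invariance moves the difference quotient from the test function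
    to f, whatever the regularity of f; the quotients of the test function converge
    and are dominated. *)
Lemma cvg_difference_quotient f phi j : measurable3 setT f -> locally_bounded f ->
  C1c setT phi ->
  (fun k => integral3 setT (fun x =>
     k.+1%:R * (f x - f (x + k.+1%:R^-1 *: e_ j)) * phi x)) @ \oo -->
  integral3 setT (fun x => f x * pderiv j phi x).
Proof.
move=> mf bf C1; have [M [B [M0 B0 supp phiB dphiB]]] := C1c_bounds C1.
have [cphi dphi cd _ _] := C1.
have mphi : measurable3 setT phi by exact: continuous_measurable3.
have md : measurable3 setT (pderiv j phi) by exact: continuous_measurable3.
have phi0 x : M < `|x| -> phi x = 0 by move=> /supp[].
have d0 x : M < `|x| -> pderiv j phi x = 0 by move=> /supp[].
pose h k : R := k.+1%:R^-1.
have h0 k : 0 < h k by rewrite invr_gt0.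
have h1 k : h k <= 1 by rewrite invf_le1// ler1n.
have hE k : `|h k *: e_ j| <= 1.
  rewrite normrZ (gtr0_norm (h0 k)) (le_trans (ler_piMr _ (norm_delta j)))//.
  exact: ltW.
have far k x : M + 1 < `|x| -> M < `|x - h k *: e_ j|.
  move=> xM; have := ler_normD (x - h k *: e_ j) (h k *: e_ j); rewrite subrK => xle.
  by have := hE k; lra.
pose q k x := k.+1%:R * (phi x - phi (x - h k *: e_ j)).
have qB k x : `|q k x| <= B.
  rewrite normrM ger0_norm// -ler_pdivlMl// mulrC.
  exact: C1c_quotient_bound.
have q0 k x : M + 1 < `|x| -> q k x = 0.
  by move=> xM; rewrite /q phi0 ?phi0 ?subrr ?mulr0//; [exact: far|lra].
have mq k : measurable3 setT (q k).
  apply: measurable3M; first exact: measurable3_cst.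
  by apply: measurable3B => //; exact: measurable3_translate.
have swap k : integral3 setT (fun x => k.+1%:R * (f x - f (x + h k *: e_ j)) * phi x) =
    integral3 setT (fun x => f x * q k x).
  pose c : R := k.+1%:R.
  pose F1 x := f x * (c * phi x); pose F2 x := f x * (c * phi (x - h k *: e_ j)).
  pose F3 x := f (x + h k *: e_ j) * (c * phi x).
  have mcphi : measurable3 setT (fun x => c * phi x).
    by apply: measurable3M => //; exact: measurable3_cst.
  have mcphi' : measurable3 setT (fun x => c * phi (x - h k *: e_ j)).
    by apply: measurable3M; [exact: measurable3_cst|exact: measurable3_translate].
  have cphiB x : `|c * phi x| <= c * B by rewrite normrM ger0_norm// ler_pM2l.
  have i1 : integrable3 setT F1.
    apply: (@box_product_integrable _ _ M (c * B)) => // x xM.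
    by rewrite phi0// mulr0.
  have i2 : integrable3 setT F2.
    apply: (@box_product_integrable _ _ (M + 1) (c * B)) => // x xM.
    by rewrite phi0 ?mulr0//; exact: far.
  have i3 : integrable3 setT F3.
    apply: (@box_product_integrable _ _ M (c * B)) => //.
    - exact: measurable3_translate.
    - exact: locally_bounded_translate.
    - by move=> x xM; rewrite phi0// mulr0.
  transitivity (integral3 setT (fun x => F1 x - F3 x)).
    by apply: eq_integral => p _; congr _%:E; rewrite /F1 /F3 -/c; ring.
  transitivity (integral3 setT (fun x => F1 x - F2 x)); last first.
    by apply: eq_integral => p _; congr _%:E; rewrite /F1 /F2 /q -/c; ring.
  rewrite !integral3B//; congr (_ - _)%E.
  rewrite -[RHS](integral3_translate (h k *: e_ j))//; last exact: measurable3M.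
  by apply: eq_integral => p _; rewrite /F3 /F2 addrK.
rewrite (_ : (fun k => _) = (fun k => integral3 setT (fun x => f x * q k x))); last first.
  by apply/funext => k; rewrite -swap.
rewrite /integral3 preimage_setT.
have [Bf hBf] := bf (M + 1).
pose G := fun p : coords3 R => ((`|Bf| * B) * \1_(@of_coords R @^-1` box (M + 1)) p)%:E.
have := @dominated_convergence _ _ _ (@lebesgue3 R) setT measurableT
  (fun k p => (f (of_coords p) * q k (of_coords p))%:E)
  (fun p => (f (of_coords p) * pderiv j phi (of_coords p))%:E) G.
case=> //.
- by move=> k; apply/measurable_EFinP; exact: measurable3M.
- by apply/measurable_EFinP; exact: measurable3M.
- apply: aeW => p _; apply: cvg_EFin; first exact: nearW.
  apply: cvgM; first exact: cvg_cst.
  exact: C1c_quotient_cvg.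
- exact: box_indic_integrable.
- apply: aeW => p k _; rewrite /G lee_fin normrM.
  have [xM|xM] := leP `|of_coords p| (M + 1).
    by rewrite indicE mem_set// mulr1 ler_pM// (le_trans (hBf _ xM))// ler_norm.
  by rewrite q0// normr0 mulr0 !mulr_ge0.
Qed.
End IBP.

Section Consequences.
Context {R : realType}.
Implicit Types (x y v : 'cV[R]_3) (p : coords3 R) (f g phi : 'cV[R]_3 -> R) (M : R).
Notation e_ j := (delta_mx j 0 : 'cV[R]_3).

Lemma lipschitz_locally_bounded f (L : R) :
  (forall x y, `|f x - f y| <= L * `|x - y|) -> locally_bounded f.
Proof.
move=> fL M; exists (`|f 0| + `|L| * M) => x xM.
have -> : f x = f 0 + (f x - f 0) by rewrite addrC subrK.
rewrite (le_trans (ler_normD _ _))// lerD2l (le_trans (fL x 0))// subr0.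
by rewrite (le_trans (ler_wpM2r _ (ler_norm L)))// ler_wpM2l.
Qed.

Lemma measurable3_quotient (j : 'I_3) k f : measurable3 setT f ->
  measurable3 setT (fun x => k.+1%:R * (f x - f (x + k.+1%:R^-1 *: e_ j))).
Proof.
move=> mf; apply: measurable3M; first exact: measurable3_cst.
by apply: measurable3B => //; exact: measurable3_translate.
Qed.

(** The quotients of a Lipschitz function are bounded by its Lipschitz constant, so
    dominated convergence identifies the limit in cvg_difference_quotient. *)
Lemma weak_derivative f Df (L : R) (j : 'I_3) phi : measurable3 setT f -> measurable3
  setT Df -> 0 <= L ->
  (forall x y, `|f x - f y| <= L * `|x - y|) ->
  (forall x, (fun k => k.+1%:R * (f (x + k.+1%:R^-1 *: e_ j) - f x)) @ \oo --> Df x) ->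
  C1c setT phi ->
  integral3 setT (fun x => f x * pderiv j phi x) =
  (- integral3 setT (fun x => (Df x * phi x)%R))%E.
Proof.
move=> mf mDf L0 fL fDf C1; have [M [B [M0 B0 supp phiB _]]] := C1c_bounds C1.
have phi0 x : M < `|x| -> phi x = 0 by move=> /supp[].
have mphi : measurable3 setT phi by apply: continuous_measurable3; case: C1.
have h0 k : 0 <= k.+1%:R^-1 :> R by rewrite invr_ge0.
have quotB k x : `|k.+1%:R * (f x - f (x + k.+1%:R^-1 *: e_ j))| <= L.
  rewrite normrM ger0_norm// -ler_pdivlMl// (le_trans (fL _ _))// opprD addNKr normrN.
  rewrite mulrC ler_wpM2r// normrZ ger0_norm//.
  by rewrite ler_piMr// norm_delta.
have DfB x : `|Df x| <= L.
  have /cvg_norm nDf := fDf x.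
  rewrite -(cvg_lim (@Rhausdorff _) nDf); apply: limr_le.
    by apply/cvg_ex; eexists; exact: nDf.
  apply: nearW => k.
  by rewrite -normrN -mulrN opprB quotB.
have int_Dphi : integrable3 setT (fun x => Df x * phi x).
  apply: (@box_product_integrable _ _ _ M B) => //.
  by move=> C; exists L.
have lim1 := cvg_difference_quotient (j := j) mf (lipschitz_locally_bounded fL) C1.
pose G := fun p : coords3 R => ((L * B) * \1_(@of_coords R @^-1` box M) p)%:E.
have := @dominated_convergence _ _ _ (@lebesgue3 R) setT measurableT
  (fun k p => (k.+1%:R * (f (of_coords p) - f (of_coords p + k.+1%:R^-1 *: e_ j)) * phi
    (of_coords p))%:E)
  (fun p => (- (Df (of_coords p) * phi (of_coords p)))%:E) G.
case=> //.
- by move=> k; apply/measurable_EFinP; exact: (measurable3M (measurable3_quotient j k mf) mphi).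
- by apply/measurable_EFinP; apply: measurable_funN; exact: measurable3M.
- apply: aeW => p _; apply: cvg_EFin; first exact: nearW.
  rewrite -mulNr; apply: cvgMl; have := fDf (of_coords p) => /cvgN; apply: cvg_trans.
  by apply: near_eq_cvg; apply: nearW => k /=; rewrite -mulrN opprB.
- exact: box_indic_integrable.
- apply: aeW => p k _; rewrite /G lee_fin normrM.
  have [xM|xM] := leP `|of_coords p| M.
    by rewrite indicE mem_set// mulr1 ler_pM.
  by rewrite phi0// normr0 mulr0 !mulr_ge0.
move=> _ _ lim2.
rewrite /integral3 preimage_setT in lim1 *.
rewrite -(cvg_lim (@ereal_hausdorff _) lim1) (cvg_lim (@ereal_hausdorff _) lim2).
rewrite -integralN//; last first.
  by rewrite /integrable3 preimage_setT in int_Dphi; exact: integrable_add_def.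
Qed.

(** In the k-th quotient only the points of bad k contribute, each of them at most
    2 K (k+1), and the measure of bad k is at most C / (k+1). *)
Lemma variation_term f phi (j : 'I_3) (K C : R) (bad : nat -> set (coords3 R)) (Omega :
  set 'cV[R]_3) :
  measurable3 setT f -> (forall x, `|f x| <= K) ->
  C1c Omega phi -> (forall x, `|phi x| <= 1) ->
  (forall k, measurable (bad k)) ->
  (forall k, (lebesgue3 (bad k) <= (C / k.+1%:R)%:E)%E) ->
  (forall k p, Omega (of_coords p) -> ~ bad k p ->
    f (of_coords p + k.+1%:R^-1 *: e_ j) = f (of_coords p)) ->
  (integral3 setT (fun x => f x * pderiv j phi x)%R <= (2 * K * C)%:E)%E.
Proof.
move=> mf fK C1 phi1 mbad badC fbad.
have C1T : C1c setT phi by case: C1 => *; split.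
have K0 : 0 <= K by exact: le_trans (fK 0).
have fb : locally_bounded f by move=> M; exists K.
have lim1 := cvg_difference_quotient (j := j) mf fb C1T.
have mphi : measurable3 setT phi by apply: continuous_measurable3; case: C1.
rewrite -(cvg_lim (@ereal_hausdorff _) lim1).
apply: lime_le; first by apply/cvg_ex; eexists; exact: lim1.
apply: nearW => k.
rewrite /integral3 preimage_setT.
have -> : (2 * K * C)%:E = ((2 * K * k.+1%:R)%:E * (C / k.+1%:R)%:E)%E.
  have E (c : R) : c != 0 -> 2 * K * c * (C / c) = 2 * K * C by move=> c0; field.
  by rewrite -EFinM E// pnatr_eq0.
apply: (@le_trans _ _ ((2 * K * k.+1%:R)%:E * lebesgue3 (bad k))%E); last first.
  by apply: lee_wpmul2l => //; rewrite lee_fin !mulr_ge0.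
have -> : lebesgue3 (bad k) = (\int[@lebesgue3 R]_p (\1_(bad k) p)%:E)%E.
  by rewrite integral_indic// setIT.
apply: (le_trans (lee_abs _)); apply: (le_trans (le_abse_integral _ _ _)) => //.
  by apply/measurable_EFinP; exact: (measurable3M (measurable3_quotient j k mf) mphi).
rewrite -ge0_integralZl//; last 2 first.
- by apply/measurable_EFinP; exact: measurable_indic.
- by rewrite lee_fin !mulr_ge0.
apply: ge0_le_integral => //.
- apply: measurableT_comp => //.
  by apply/measurable_EFinP; exact: (measurable3M (measurable3_quotient j k mf) mphi).
- by apply: measurable_funeM; apply/measurable_EFinP; exact: measurable_indic.
move=> p _; rewrite abse_EFin -EFinM lee_fin normrM.
have [->|phi0] := eqVneq (phi (of_coords p)) 0.
  by rewrite normr0 mulr0 !mulr_ge0.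
have Op : Omega (of_coords p).
  by case: C1 => _ _ _ _; apply; exact: subset_closure.
have [pb|pb] := pselect (bad k p); last first.
  by rewrite fbad// subrr mulr0 normr0 mul0r !mulr_ge0.
rewrite indicE mem_set// mulr1 -[leRHS]mulr1 ler_pM// normrM ger0_norm// [leRHS]mulrC
  ler_wpM2l//.
by rewrite (le_trans (ler_normB _ _))// mulrDl !mul1r lerD.
Qed.

(** The set bad k is meant to contain the points of Omega that a step of length
    1/(k+1) carries across a jump of chi: a Minkowski content of the jump set
    bounds the total variation. *)
Lemma variation3_le (Omega : set 'cV[R]_3) (chi : 'cV[R]_3 -> 'M[R]_3) (K C : R)
    (bad : nat -> set (coords3 R)) :
  (forall i j, measurable3 setT (fun x => chi x i j)) ->
  (forall x i j, `|chi x i j| <= K) ->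
  (forall k, measurable (bad k)) ->
  (forall k, (lebesgue3 (bad k) <= (C / k.+1%:R)%:E)%E) ->
  (forall k p (j : 'I_3), Omega (of_coords p) -> ~ bad k p ->
    chi (of_coords p + k.+1%:R^-1 *: e_ j) = chi (of_coords p)) ->
  (variation3 Omega chi <= (54 * K * C)%:E)%E.
Proof.
move=> mchi chiK mbad badC chibad; apply: ub_ereal_sup => _ [phi [C1 phi1] ->].
have C1T k i j : C1c setT (phi k i j) by case: (C1 k i j) => *; split.
have phi1' k i j x : `|phi k i j x| <= 1.
  rewrite -(expr_le1 (n := 2))// real_normK ?num_real//.
  have le_sum (F : 'I_3 -> R) l : (forall m, 0 <= F m) -> F l <= \sum_m F m.
    by move=> F0; rewrite (bigD1 l)//= lerDl sumr_ge0.
  apply: le_trans (phi1 x); apply: le_trans (le_sum _ k _) => [|m]; last first.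
    by rewrite sumr_ge0// => *; rewrite sumr_ge0// => *; rewrite sqr_ge0.
  apply: le_trans (le_sum _ i _) => [|m]; last by rewrite sumr_ge0// => *; rewrite sqr_ge0.
  by apply: le_trans (le_sum _ j _) => [//|m]; rewrite sqr_ge0.
have int_term k i j : integrable3 setT (fun x => chi x i j * pderiv k (phi k i j) x).
  have [M [B [_ _ supp _ dB]]] := C1c_bounds (C1T k i j).
  apply: (@box_product_integrable _ _ _ M B) => //.
  - by apply: continuous_measurable3; case: (C1T k i j).
  - by move=> M'; exists K.
  - by move=> x /supp[].
rewrite [leLHS](_ : _ = (\sum_k \sum_i \sum_j
    integral3 setT (fun x => chi x i j * pderiv k (phi k i j) x)%R)%E); last first.
  have supp x : ~ Omega x -> forall k i j, pderiv k (phi k i j) x = 0.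
    move=> nx k i j; apply: pderiv_off_support => cx; apply: nx.
    by case: (C1 k i j) => _ _ _ _; exact.
  rewrite {1}/integral3 integral_mkcond.
  transitivity (\int[@lebesgue3 R]_p (\sum_k \sum_i \sum_j
      (chi (of_coords p) i j * pderiv k (phi k i j) (of_coords p))%:E))%E.
    apply: eq_integral => p _; rewrite patchE; case: ifPn => [_|].
      rewrite (eq_bigr (fun k => (\sum_i \sum_j chi (of_coords p) i j * pderiv k (phi k i
        j) (of_coords p))%:E)); last first.
        by move=> k _; rewrite -sumEFin; apply: eq_bigr => i _; rewrite -sumEFin.
      rewrite sumEFin; congr _%:E; rewrite [RHS]exchange_big/=; apply: eq_bigr => i _.
      rewrite [RHS]exchange_big/=; apply: eq_bigr => j _.
      by rewrite mulr_sumr.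
    rewrite notin_setE => /= nx; rewrite big1// => k _; rewrite big1// => i _.
    by rewrite big1// => j _; rewrite supp// mulr0.
  have int_term' k i j : (@lebesgue3 R).-integrable setT (fun p =>
      (chi (of_coords p) i j * pderiv k (phi k i j) (of_coords p))%:E).
    by have := int_term k i j; rewrite /integrable3 preimage_setT.
  rewrite integral_sum//; last first.
    by move=> k; apply: integrable_sum => // i _; apply: integrable_sum.
  apply: eq_bigr => k _; rewrite integral_sum//; last first.
    by move=> i; apply: integrable_sum.
  by apply: eq_bigr => i _; rewrite integral_sum.
(* 54 = 3 * 3 * 3 * 2, one term for each component of the test fields *)
rewrite (_ : 54 * K * C = \sum_(k < 3) \sum_(i < 3) \sum_(j < 3) (2 * K * C)); last first.
  by rewrite !sumr_const !card_ord -!mulrnA -mulr_natr; ring.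
rewrite -sumEFin; apply: lee_sum => k _; rewrite -sumEFin; apply: lee_sum => i _.
rewrite -sumEFin; apply: lee_sum => j _.
apply: (variation_term _ _ (C1 k i j) _ mbad badC) => //.
by move=> n p Op pb; rewrite chibad.
Qed.

End Consequences.

(** * The measure of the kinks *)

Section Interfaces.
Context {R : realType}.
Notation T := (measurableTypeR R).
Notation mu := (@lebesgue_measure R).
Implicit Types (c h eta s t y d : R) (i j n m : nat).

Definition side : set T := `[- 2^-1, 2^-1].

Lemma side_measure : mu side = 1%E.
Proof.
rewrite lebesgue_measure_itv /= lte_fin ifT; last by lra.
by rewrite -EFinB; congr _%:E; lra.
Qed.

Lemma measurable_side : measurable side. Proof. exact: measurable_itv. Qed.

Lemma measurable_near disp (X : measurableType disp) (f : X -> T) (g : X -> T) eta :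
  measurable_fun setT f -> measurable_fun setT g ->
  measurable [set x | `|f x - g x| <= eta].
Proof.
move=> mf mg; rewrite -[X in measurable X]setTI.
have mfg : measurable_fun setT (fun x => f x - g x) by exact: measurable_funB.
have mP : measurable_fun setT (fun x => `|f x - g x| <= eta).
  by apply: measurable_fun_ler => //; exact: (measurableT_comp (@normr_measurable R setT) mfg).
exact: (mP measurableT [set true]).
Qed.

Lemma measurable_fold disp (X : measurableType disp) (c : X -> nat -> T) (y : X -> T) n :
  (forall j, measurable_fun setT (fun x => c x j)) -> measurable_fun setT y ->
  measurable_fun setT (fun x => fold_wave (c x) n (y x)) /\
  measurable_fun setT (fun x => fold_sign (c x) n (y x)).
Proof.
move=> mc my; elim: n => [|n [IHw IHs]] /=; split.
- apply: measurable_funB => //; exact: (measurableT_comp (@normr_measurable R setT) my).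
- by apply: measurable_fun_ifT => //; exact: measurable_fun_ltr.
- apply: measurable_minr => //; apply: measurable_funB => //.
  by apply: measurable_funM => //; exact: mc.
- apply: measurable_fun_ifT => //; first exact: (measurable_fun_ltr IHw (mc n)).
  exact: measurable_funN.
Qed.

Lemma measurable_tooth n : measurable_fun setT (fun y : T => tooth n y : T).
Proof.
by have [] := @measurable_fold _ T (fun _ => fold_level) id n; [|exact: measurable_id|].
Qed.

Lemma mirror_strip_measure c eta : 0 <= eta ->
  (mu [set s : T | (`|(2^-1 - `|s|) - c| <= eta)%R] <= (4 * eta)%:E)%E.
Proof.
move=> eta0; pose b := 2^-1 - c : R.
have len (u : R) : mu (`[u - eta, u + eta] : set T) = (2 * eta)%:E.
  rewrite lebesgue_measure_itv /= lte_fin; case: ltP => h.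
    by rewrite -EFinB; congr _%:E; ring.
  by congr _%:E; lra.
apply: (@le_trans _ _ (mu (`[b - eta, b + eta] `|` `[- b - eta, - b + eta]))).
  apply: le_measure; rewrite ?inE.
  - apply: (@measurable_near _ T (fun s => 2^-1 - `|s|) (fun=> c)) => //.
    by apply: measurable_funB.
  - exact: measurableU.
  move=> s /=; rewrite !in_itv/= ler_norml => /andP[h1 h2].
  have [s0|s0] := leP 0 s; [left|right]; apply/andP.
    by move: h1 h2; rewrite ger0_norm// /b => h1 h2; split; lra.
  by move: h1 h2; rewrite ltr0_norm// /b => h1 h2; split; lra.
apply: (le_trans (measureU2 _ _ _)) => //.
have lenU : (mu (`[(b - eta)%R, (b + eta)%R] : set T) + mu (`[(- b - eta)%R, (- b +
  eta)%R] : set T) <= (4 * eta)%:E)%E.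
  by rewrite (len b) (len (- b)) -EFinD lee_fin; lra.
exact: lenU.
Qed.

(** A reflection at most doubles the number of points at a given height. *)
Lemma tooth_measure n c eta : 0 <= eta ->
  (mu [set y : T | (`|tooth n y - c| <= eta)%R] <= (2 ^+ n * (4 * eta))%:E)%E.
Proof.
move=> eta0; elim: n c => [|n IH] c; first by rewrite expr0 mul1r; exact: mirror_strip_measure.
pose c' := 2 * fold_level n - c : R.
have mt c0 : measurable [set y : T | `|tooth n y - c0| <= eta].
  by apply: measurable_near => //; exact: measurable_tooth.
apply: (@le_trans _ _ (mu ([set y : T | `|tooth n y - c| <= eta] `|` [set y : T | `|tooth
  n y - c'| <= eta]))).
  apply: le_measure; rewrite ?inE.
  - by apply: measurable_near => //; exact: measurable_tooth.
  - exact: measurableU.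
  move=> y /=; rewrite {1}/tooth /= -/(tooth n y).
  have [le|/ltW le] := leP (tooth n y) (2 * fold_level n - tooth n y).
    by left.
  move=> h; right; rewrite -normrN; apply: le_trans h; rewrite le_eqVlt; apply/orP; left;
    apply/eqP.
  by congr `|_|; rewrite /c'; ring.
apply: (le_trans (measureU2 _ _ _)) => //.
apply: (le_trans (leeD (IH _) (IH _))).
by rewrite -EFinD lee_fin exprS; lra.
Qed.

(** The distance to the boundary inside the square, negative outside. *)
Definition edge_depth (q : coords2 R) : T :=
  Num.min (2^-1 - `|q.1|) (2^-1 - `|q.2|).

Lemma measurable_edge_depth : measurable_fun setT edge_depth.
Proof.
apply: measurable_minr; apply: measurable_funB => //.
  exact: (measurableT_comp (@normr_measurable R setT) measurable_fst).
exact: (measurableT_comp (@normr_measurable R setT) measurable_snd).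
Qed.

Definition square : set (coords2 R) := side `*` side.

Lemma measurable_square : measurable square.
Proof. by apply: measurableX; exact: measurable_side. Qed.

Lemma square_measure : lebesgue2 square = 1%E.
Proof. by rewrite lebesgue2X ?side_measure ?mule1//; exact: measurable_side. Qed.

Lemma frame_measure c eta : 0 <= eta ->
  (lebesgue2 (square `&` [set q | (`|edge_depth q - c| <= eta)%R]) <= (8 * eta)%:E)%E.
Proof.
move=> eta0; pose A : set T := [set s : T | `|(2^-1 - `|s|) - c| <= eta].
have mA : measurable A.
  apply: (@measurable_near _ T (fun s => 2^-1 - `|s|) (fun=> c)) => //.
  by apply: measurable_funB.
have mS := measurable_side.
apply: (@le_trans _ _ (lebesgue2 ((A `*` side) `|` (side `*` A)))).
  apply: le_measure; rewrite ?inE.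
  - apply: measurableI; first exact: measurable_square.
    by apply: measurable_near => //; exact: measurable_edge_depth.
  - by apply: measurableU; exact: measurableX.
  move=> [s t] [[/= hs ht]]; rewrite /edge_depth /=.
  have [le|/ltW le] := leP (2^-1 - `|s|) (2^-1 - `|t|).
    by left.
  by right.
apply: (@le_trans _ _ (lebesgue2 (A `*` side) + lebesgue2 (side `*` A))%E).
  by apply: measureU2; exact: measurableX.
rewrite !lebesgue2X// side_measure mule1 mul1e.
apply: (le_trans (leeD (mirror_strip_measure c eta0) (mirror_strip_measure c eta0))).
by rewrite -EFinD lee_fin; lra.
Qed.

Lemma rim_measure c : 0 <= c ->
  (lebesgue2 (square `&` [set q | (edge_depth q <= c)%R]) <= (4 * c)%:E)%E.
Proof.
move=> c0; have c2 : 0 <= c / 2 by lra.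
rewrite (_ : 4 * c = 8 * (c / 2)); last by field.
apply: le_trans (frame_measure (c / 2) c2).
apply: le_measure; rewrite ?inE.
- apply: measurableI; first exact: measurable_square.
  have := measurable_fun_ler measurable_edge_depth (measurable_cst c).
  by move=> /(_ measurableT [set true]); rewrite setTI; exact.
- apply: measurableI; first exact: measurable_square.
  by apply: measurable_near => //; exact: measurable_edge_depth.
move=> [s t] [] sq /=; split=> //=; move: sq => -[].
rewrite /side /= !in_itv /= -!ler_norml => hs ht.
have d0 : 0 <= edge_depth (s, t) by rewrite /edge_depth /= le_min !subr_ge0 hs ht.
by rewrite ler_norml; apply/andP; split; lra.
Qed.

End Interfaces.

Section CriticalSet.
Context {R : realType}.
Notation T := (measurableTypeR R).
Notation mu := (@lebesgue_measure R).
Implicit Types (c h eta s t y d : R) (i j n m : nat).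

Definition kink_plane h : set (coords3 R) := square `*` [set y | `|y| <= h].
Definition layer_wall m h j : set (coords3 R) :=
  (square `&` [set q | `|edge_depth q - layer_depth m j| <= h]) `*` side.
Definition rim m j : set (coords2 R) := square `&` [set q | edge_depth q <= layer_depth m j].
Definition fold_wall m h j : set (coords3 R) :=
  (rim m j `*` setT) `&`
  [set p | `|tooth j p.2 - threshold m (edge_depth p.1) j| <= 2 * h].

(** The places listed in near_kink, in the rotated coordinates ((x.n, x.d), x.b32)
    and inside the cube: see not_critical. *)
Definition critical m n h : set (coords3 R) :=
  kink_plane h `|` \big[setU/set0]_(j < n.+1) layer_wall m h j
  `|` \big[setU/set0]_(j < n) fold_wall m h j.

Lemma measurable_kink_plane h : measurable (kink_plane h).
Proof.
apply: measurableX; first exact: measurable_square.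
rewrite (_ : [set _ | _] = [set y : T | `|y - 0| <= h]); last first.
  by apply/seteqP; split => y /=; rewrite subr0.
exact: measurable_near.
Qed.

Lemma kink_plane_measure h : 0 <= h -> (lebesgue3 (kink_plane h) <= (2 * h)%:E)%E.
Proof.
move=> h0.
have -> : kink_plane h = square `*` (`[- h, h] : set T).
  by apply/seteqP; split => -[q y] []/= sq; rewrite ?in_itv/= -?ler_norml => yh; split =>
    //=; rewrite ?in_itv/= -?ler_norml.
rewrite lebesgue3X//; last exact: measurable_square.
rewrite square_measure mul1e lebesgue_measure_itv /= lte_fin.
by case: ifP => _; rewrite -?EFinB lee_fin; lra.
Qed.

Lemma measurable_layer_wall m h j : measurable (layer_wall m h j).
Proof.
apply: measurableX; last exact: measurable_side.
apply: measurableI; first exact: measurable_square.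
by apply: measurable_near => //; exact: measurable_edge_depth.
Qed.

Lemma layer_wall_measure m h j : 0 <= h -> (lebesgue3 (layer_wall m h j) <= (8 * h)%:E)%E.
Proof.
move=> h0; rewrite lebesgue3X; [|apply: measurableI|exact: measurable_side].
- by rewrite side_measure mule1; exact: frame_measure.
- exact: measurable_square.
- by apply: measurable_near => //; exact: measurable_edge_depth.
Qed.

Lemma measurable_rim m j : measurable (rim m j).
Proof.
apply: measurableI; first exact: measurable_square.
have := measurable_fun_ler (@measurable_edge_depth R) (measurable_cst (layer_depth m j)).
by move=> /(_ measurableT [set true]); rewrite setTI; exact.
Qed.

Lemma rim_le m j : (lebesgue2 (rim m j) <= (4 * layer_depth m j)%:E)%E.
Proof. by apply: rim_measure; exact/ltW/layer_depth_gt0. Qed.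

Lemma rim_le1 m j : (lebesgue2 (rim m j) <= 1)%E.
Proof.
rewrite -square_measure; apply: le_measure; rewrite ?inE.
- exact: measurable_rim.
- exact: measurable_square.
- exact: subIsetl.
Qed.

Lemma measurable_threshold m j : measurable_fun setT (fun d : T => threshold m d j : T).
Proof. by apply: measurable_maxr => //; exact: measurable_funM. Qed.

Lemma measurable_fold_wall m h j : measurable (fold_wall m h j).
Proof.
apply: measurableI; first by apply: measurableX => //; exact: measurable_rim.
apply: measurable_near.
  exact: (measurableT_comp (measurable_tooth j) measurable_snd).
apply: (measurableT_comp (measurable_threshold m j)).
exact: (measurableT_comp (@measurable_edge_depth R) measurable_fst).
Qed.

(** Over a fixed point of the cross-section the threshold is fixed, and
    tooth_measure applies; then integrate over the rim. *)
Lemma fold_wall_measure m h j : 0 <= h ->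
  (lebesgue3 (fold_wall m h j) <= (2 ^+ j * (8 * h))%:E * lebesgue2 (rim m j))%E.
Proof.
move=> h0.
have -> : lebesgue3 (fold_wall m h j) = (\int[@lebesgue2 R]_q mu (xsection (fold_wall m h
  j) q))%E by [].
have -> : ((2 ^+ j * (8 * h))%:E * lebesgue2 (rim m j) =
    \int[@lebesgue2 R]_q ((2 ^+ j * (8 * h))%:E * (\1_(rim m j) q)%:E))%E.
  rewrite ge0_integralZl//; last 2 first.
  - by apply/measurable_EFinP; apply: measurable_indic; exact: measurable_rim.
  - by rewrite lee_fin !mulr_ge0// exprn_ge0.
  rewrite integral_indic//; last exact: measurable_rim.
  by rewrite setIT.
apply: ge0_le_integral => //.
- by apply: measurable_fun_xsection; exact: measurable_fold_wall.
- by apply: measurable_funeM; apply/measurable_EFinP; apply: measurable_indic; exact: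
  measurable_rim.
move=> q _; rewrite indicE; have [qr|qr] := boolP (q \in rim m j).
  rewrite mule1 (_ : 8 * h = 4 * (2 * h)); last by ring.
  apply: le_trans (tooth_measure j (threshold m (edge_depth q) j) _); last by lra.
  apply: le_measure; rewrite ?inE.
  - by apply: measurable_xsection; exact: measurable_fold_wall.
  - by apply: measurable_near => //; exact: measurable_tooth.
  by move=> y; rewrite xsectionE /= => -[].
rewrite mule0 (_ : xsection _ _ = set0) ?measure0//.
rewrite -subset0 => y; rewrite xsectionE /= => -[[/= qr' _] _].
by move: qr; rewrite notin_setE.
Qed.

(** The density 2^j of the kinks of generation j times the area where they occur,
    which is at most 1 and at most 4 layer_depth m j. *)
Definition fold_weight m j : R :=
  if (j < m)%N then 2 ^+ j else 4 * (2 ^+ j * layer_depth m j).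

(** The first m generations fill the cross-section and add up to 2^m; the later
    ones form a geometric series of ratio 2/3. *)
Lemma sum_fold_weight m n : \sum_(j < n) fold_weight m j <= 13 * 2 ^+ m.
Proof.
have lo k : (k <= m)%N -> \sum_(j < k) fold_weight m j <= 2 ^+ k.
  elim: k => [|k IH] km; first by rewrite big_ord0 expr0.
  rewrite big_ord_recr /= [X in _ + X]/fold_weight km exprS.
  by have := IH (ltnW km); lra.
have hi k : \sum_(j < m + k) fold_weight m j <= 2 ^+ m * (13 - 12 * (2 / 3) ^+ k).
  elim: k => [|k IH]; first by rewrite addn0 expr0; have := lo m (leqnn m); lra.
  rewrite addnS big_ord_recr /= [X in _ + X]/fold_weight ltnNge leq_addr /=.
  have -> : 4 * (2 ^+ (m + k) * layer_depth m (m + k)) = 4 * (2 ^+ m * (2 / 3) ^+ k) :> R.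
    rewrite /layer_depth !exprD expr_div_n; field.
    by rewrite !expf_neq0.
  by rewrite exprS; lra.
have [nm|/ltnW mn] := leqP n m.
  apply: le_trans (lo n nm) _; apply: (@le_trans _ _ (2 ^+ m)).
    by rewrite ler_eXn2l// ltr1n.
  by rewrite ler_peMl ?exprn_ge0// ler1n.
rewrite -(subnKC mn); apply: le_trans (hi _) _.
rewrite mulrC ler_pM2r ?exprn_gt0// gerBl mulr_ge0// exprn_ge0//.
Qed.

Lemma fold_wall_le m h j : 0 <= h ->
  (lebesgue3 (fold_wall m h j) <= (8 * h * fold_weight m j)%:E)%E.
Proof.
move=> h0; apply: (le_trans (fold_wall_measure m j h0)).
have c0 : (0 <= (2 ^+ j * (8 * h))%:E)%E by rewrite lee_fin !mulr_ge0// exprn_ge0.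
rewrite /fold_weight; case: ifP => _.
  apply: (le_trans (lee_wpmul2l c0 (rim_le1 m j))).
  by rewrite mule1 lee_fin mulrC.
apply: (le_trans (lee_wpmul2l c0 (rim_le m j))).
by rewrite -EFinM lee_fin le_eqVlt; apply/orP; left; apply/eqP; ring.
Qed.

Lemma measurable_critical m n h : measurable (critical m n h).
Proof.
apply: measurableU; first apply: measurableU.
- exact: measurable_kink_plane.
- by apply: bigsetU_measurable => j _; exact: measurable_layer_wall.
- by apply: bigsetU_measurable => j _; exact: measurable_fold_wall.
Qed.

Lemma critical_measure m n h : 0 <= h ->
  (lebesgue3 (critical m n h) <= ((2 + 8 * n.+1%:R + 104 * 2 ^+ m) * h)%:E)%E.
Proof.
move=> h0.
have mW : measurable (\big[setU/set0]_(j < n.+1) layer_wall m h j).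
  by apply: bigsetU_measurable => j _; exact: measurable_layer_wall.
have mF : measurable (\big[setU/set0]_(j < n) fold_wall m h j).
  by apply: bigsetU_measurable => j _; exact: measurable_fold_wall.
have mK := measurable_kink_plane h.
apply: (@le_trans _ _ (lebesgue3 (kink_plane h `|` \big[setU/set0]_(j < n.+1) layer_wall
  m h j) +
  lebesgue3 (\big[setU/set0]_(j < n) fold_wall m h j))%E).
  by apply: measureU2 => //; exact: measurableU.
(* 104 = 8 * 13, with 13 from sum_fold_weight *)
rewrite (_ : _ * h = (2 * h + n.+1%:R * (8 * h)) + 8 * h * (13 * 2 ^+ m)); last by ring.
rewrite EFinD; apply: leeD.
  apply: (@le_trans _ _ (lebesgue3 (kink_plane h) + lebesgue3 (\big[setU/set0]_(j < n.+1)
    layer_wall m h j))%E).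
    exact: measureU2.
  rewrite EFinD; apply: leeD; first exact: kink_plane_measure.
  apply: (@le_trans _ _ (\sum_(j < n.+1) lebesgue3 (layer_wall m h j))%E).
    by apply: (@Boole_inequality _ _ _ (@lebesgue3 R) (layer_wall m h)) => j _; exact:
      measurable_layer_wall.
  apply: (@le_trans _ _ (\sum_(j < n.+1) (8 * h)%:E)%E).
    by apply: lee_sum => j _; exact: layer_wall_measure.
  by rewrite sumEFin lee_fin sumr_const card_ord -[leLHS]mulr_natl.
apply: (@le_trans _ _ (\sum_(j < n) lebesgue3 (fold_wall m h j))%E).
  by apply: (@Boole_inequality _ _ _ (@lebesgue3 R) (fold_wall m h)) => j _; exact:
    measurable_fold_wall.
apply: (@le_trans _ _ (\sum_(j < n) (8 * h * fold_weight m j)%:E)%E).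
  by apply: lee_sum => j _; exact: fold_wall_le.
rewrite sumEFin lee_fin -mulr_sumr ler_wpM2l ?mulr_ge0//.
exact: sum_fold_weight.
Qed.

Lemma not_critical m n h (q : coords2 R) y : square q -> `|y| <= 2^-1 ->
  ~ critical m n h (q, y) -> ~ near_kink m n h y (edge_depth q).
Proof.
move=> sq y2 nc bd; apply: nc; case: bd => [yh|[j jn dj]|[j [jn dj tj]]].
- by left; left.
- left; right; rewrite -(bigcup_mkord _ (layer_wall m h)); exists j => //.
  by split => //; rewrite /side /= in_itv /= -ler_norml.
- by right; rewrite -(bigcup_mkord _ (fold_wall m h)); exists j => //; split => //; split.
Qed.

End CriticalSet.

(** * Functions that are affine along short rays *)

Section RayAffine.
Context {R : realType}.
Implicit Types (x y v : 'cV[R]_3) (f g : 'cV[R]_3 -> R) (c : R).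

(** A one-sided condition in all directions: it holds at the kinks as well, is
    preserved by minima and maxima, and makes the forward difference quotients
    eventually constant at every point. *)
Definition ray_affine f := forall x v, exists d : R,
  \forall h \near 0^'+, f (x + h *: v) = f x + h * d.

Definition lipschitz3 f := exists2 L : R, 0 <= L &
  forall x y, `|f x - f y| <= L * `|x - y|.

(** What the construction of the weak gradient needs to know of the functions
    obtained from affine ones by sums, minima and maxima. *)
Record polyhedral f : Prop := Polyhedral {
  polyhedral_measurable : measurable3 setT f;
  polyhedral_lipschitz : lipschitz3 f;
  polyhedral_ray_affine : ray_affine f }.

Lemma polyhedral_cst c : polyhedral (cst c).
Proof.
split; first exact: measurable3_cst.
  by exists 0 => // x y; rewrite subrr normr0 mul0r.
by move=> x v; exists 0; apply: nearW => h; rewrite mulr0 addr0.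
Qed.

Lemma polyhedral_dot v : polyhedral (fun x => dot x v).
Proof.
split; first exact: measurable3_dot.
- exists (`|v 0 0| + `|v 1 0| + `|v 2 0|); first by rewrite !addr_ge0.
  move=> x y; rewrite !dotE.
  rewrite (_ : _ - _ = (x - y) 0 0 * v 0 0 + (x - y) 1 0 * v 1 0 + (x - y) 2 0 * v 2 0);
    last first.
    by rewrite !mxE; ring.
  rewrite (le_trans (ler_normD _ _))// mulrDl lerD//.
    rewrite (le_trans (ler_normD _ _))// mulrDl lerD//;
    by rewrite normrM mulrC ler_wpM2l// entry_le_norm.
  by rewrite normrM mulrC ler_wpM2l// entry_le_norm.
- by move=> x w; exists (dot w v); apply: nearW => h; rewrite dotDl dotZl.
Qed.

Lemma polyhedralD f g : polyhedral f -> polyhedral g -> polyhedral (fun x => f x + g x).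
Proof.
move=> [mf [Lf Lf0 lf] rf] [mg [Lg Lg0 lg] rg]; split.
- exact: measurable_funD.
- exists (Lf + Lg); first exact: addr_ge0.
  move=> x y; rewrite opprD addrACA (le_trans (ler_normD _ _))// mulrDl.
  exact: lerD.
- move=> x v; have [df hf] := rf x v; have [dg hg] := rg x v; exists (df + dg).
  by near=> h; rewrite (near hf h)// (near hg h)//; ring.
Unshelve. all: by end_near. Qed.

Lemma polyhedralZ c f : polyhedral f -> polyhedral (fun x => c * f x).
Proof.
move=> [mf [Lf Lf0 lf] rf]; split.
- exact: measurable_funM.
- exists (`|c| * Lf); first exact: mulr_ge0.
  by move=> x y; rewrite -mulrBr normrM -mulrA ler_wpM2l.
- move=> x v; have [df hf] := rf x v; exists (c * df).
  by near=> h; rewrite (near hf h)//; ring.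
Unshelve. all: by end_near. Qed.

Lemma polyhedralN f : polyhedral f -> polyhedral (fun x => - f x).
Proof.
by move=> /(polyhedralZ (-1)); under [X in polyhedral X -> _]eq_fun do rewrite mulN1r.
Qed.

Lemma min_lip (a b a' b' e : R) : `|a - a'| <= e -> `|b - b'| <= e ->
  `|Num.min a b - Num.min a' b'| <= e.
Proof.
rewrite !ler_norml => /andP[h1 h2] /andP[h3 h4].
by have [|] := leP a b; have [|] := leP a' b'; move=> *; apply/andP; split; lra.
Qed.

(** Where the two functions differ, the smaller one wins along a short ray; where
    they agree, the one with the smaller slope does. *)
Lemma ray_affine_min f g : ray_affine f -> ray_affine g ->
  ray_affine (fun x => Num.min (f x) (g x)).
Proof.
move=> rf rg x v; have [df hf] := rf x v; have [dg hg] := rg x v.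
wlog fg : f g {rf rg} df dg hf hg / f x < g x \/ (f x = g x /\ df <= dg).
  move=> W; have swap : (exists d, \forall h \near 0^'+, Num.min (g (x + h *: v)) (f (x +
    h *: v)) =
      Num.min (g x) (f x) + h * d) ->
      exists d, \forall h \near 0^'+, Num.min (f (x + h *: v)) (g (x + h *: v)) =
      Num.min (f x) (g x) + h * d.
    move=> [d hd]; exists d; apply: filterS hd => h.
    by rewrite minC => ->; rewrite minC.
  have [fg|[gf|fg]] : f x < g x \/ g x < f x \/ f x = g x by case: ltgtP; auto.
  - by apply: (W f g df dg hf hg); left.
  - by apply/swap/(W g f dg df hg hf); left.
  - have [d12|/ltW d21] := leP df dg.
      by apply: (W f g df dg hf hg); right.
    by apply/swap/(W g f dg df hg hf); right.
exists df.
have small : \forall h \near 0^'+, h * (df - dg) <= g x - f x.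
  case: fg => [fg|[-> dd]]; last first.
    near=> h; rewrite subrr mulr_ge0_le0 ?subr_le0//.
  have e0 : 0 < (g x - f x) / (`|df - dg| + 1) by rewrite divr_gt0 ?subr_gt0// ltr_wpDl.
  near=> h.
  have h0 : 0 < h by [].
  have he : h <= (g x - f x) / (`|df - dg| + 1) by near: h; exact: nbhs_right_le.
  rewrite (le_trans (ler_wpM2l (ltW h0) (ler_norm _)))//.
  rewrite (@le_trans _ _ (h * (`|df - dg| + 1)))//; first by rewrite ler_wpM2l ?lerDl// ltW.
  by rewrite -ler_pdivlMr// ltr_wpDl.
near=> h; rewrite (near hf h)// (near hg h)//.
have sm : h * (df - dg) <= g x - f x by near: h.
rewrite !min_l//; [|lra].
by case: fg => [/ltW|[->]].
Unshelve. all: by end_near. Qed.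

Lemma polyhedral_min f g : polyhedral f -> polyhedral g ->
  polyhedral (fun x => Num.min (f x) (g x)).
Proof.
move=> [mf [Lf Lf0 lf] rf] [mg [Lg Lg0 lg] rg]; split.
- exact: measurable_minr.
- exists (Lf + Lg); first exact: addr_ge0.
  move=> x y; apply: min_lip.
    by rewrite (le_trans (lf x y))// ler_wpM2r// lerDl.
  by rewrite (le_trans (lg x y))// ler_wpM2r// lerDr.
- exact: ray_affine_min.
Qed.

Lemma polyhedral_max f g : polyhedral f -> polyhedral g ->
  polyhedral (fun x => Num.max (f x) (g x)).
Proof.
move=> pf pg; have := polyhedralN (polyhedral_min (polyhedralN pf) (polyhedralN pg)).
by under [X in polyhedral X -> _]eq_fun do rewrite oppr_min !opprK.
Qed.

Lemma polyhedral_norm f : polyhedral f -> polyhedral (fun x => `|f x|).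
Proof.
move=> pf; have := polyhedral_max pf (polyhedralN pf).
by under [X in polyhedral X -> _]eq_fun do rewrite maxrN.
Qed.

Definition ray_slope f j x : R :=
  lim ((fun k => k.+1%:R * (f (x + k.+1%:R^-1 *: delta_mx j 0) - f x)) @ \oo).

Lemma ray_slope_cvg f (j : 'I_3) x : polyhedral f ->
  (fun k => k.+1%:R * (f (x + k.+1%:R^-1 *: delta_mx j 0) - f x)) @ \oo --> ray_slope f j x.
Proof.
move=> [_ _ /(_ x (delta_mx j 0))[d hd]].
suff : (fun k => k.+1%:R * (f (x + k.+1%:R^-1 *: delta_mx j 0) - f x)) @ \oo --> d.
  by move=> cv; rewrite /ray_slope; move/cvgP : (cv).
apply: cvg_near_cst; move: hd => [e /= e0 he].
apply: filterS (near_infty_natSinv_lt (PosNum e0)) => k /= ke.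
rewrite he/=; last by [].
  by rewrite addrC addKr mulVKf// pnatr_eq0.
by rewrite sub0r normrN ger0_norm.
Qed.

Lemma measurable_ray_slope f j : polyhedral f -> measurable3 setT (ray_slope f j).
Proof.
move=> pf; have [mf _ _] := pf.
rewrite /measurable3 preimage_setT.
apply: (measurable_fun_cvg (h := fun k p => k.+1%:R * (f (of_coords p + k.+1%:R^-1 *:
  delta_mx j 0) - f (of_coords p)))).
  move=> k; exact: (measurable3M (measurable3_cst _) (measurable3B (measurable3_translate
    _ mf) mf)).
by move=> p _; exact: ray_slope_cvg.
Qed.

End RayAffine.

(** * The scalar displacement on the rotated cube *)

Section Profile.
Context {R : realType}.
Variables m n : nat.
Hypothesis slope_le1 : forall i, (i < n)%N -> fold_slope m i <= 1 :> R.
Implicit Types (x y v : 'cV[R]_3) (h : R) (j : 'I_3).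
Notation e_ j := (delta_mx j 0 : 'cV[R]_3).

Definition axis x : R := dot x (vb32 R).
Definition cross_section x : coords2 R := (dot x (vn R), dot x (vd R)).
Definition depth x : R := edge_depth (cross_section x).

(** The scalar displacement: the branching wave in the direction b32, cut off by
    the depth to vanish on the faces normal to n and d, and extended by 0. *)
Definition profile x : R :=
  Num.max 0 (Num.min (wave m n (axis x) (depth x)) (depth x)).

(** The intended value of the derivative of the profile in the direction b32. *)
Definition phase x : R := wave_sign m n (axis x) (depth x).

Lemma polyhedral_depth : polyhedral depth.
Proof.
have side_gap v : polyhedral (fun x => 2^-1 - `|dot x v|).
  apply: (polyhedralD (polyhedral_cst _)); apply: polyhedralN.
  by apply: polyhedral_norm; exact: polyhedral_dot.
exact: (polyhedral_min (side_gap (vn R)) (side_gap (vd R))).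
Qed.

Lemma polyhedral_wave k : polyhedral (fun x => wave m k (axis x) (depth x)).
Proof.
elim: k => [|k IH].
  apply: (polyhedralD (polyhedral_cst _)); apply: polyhedralN.
  by apply: polyhedral_norm; exact: polyhedral_dot.
have pc : polyhedral (fun x => threshold m (depth x) k).
  by apply: polyhedral_max; [exact: polyhedral_cst|exact/polyhedralZ/polyhedral_depth].
apply: (polyhedral_min IH); apply: polyhedralD; first exact: polyhedralZ.
exact: polyhedralN.
Qed.

Lemma polyhedral_profile : polyhedral profile.
Proof.
apply: polyhedral_max; first exact: polyhedral_cst.
by apply: polyhedral_min; [exact: polyhedral_wave|exact: polyhedral_depth].
Qed.

Lemma measurable_phase : measurable3 setT phase.
Proof.
have [md _ _] := polyhedral_depth; have [ma _ _] := @polyhedral_dot R (vb32 R).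
rewrite /measurable3 !preimage_setT in md ma *.
have [] // := @measurable_fold R _ _ (fun p => threshold m (depth (of_coords p))) (fun p
  => axis (of_coords p)) n.
by move=> k; exact: (measurableT_comp (measurable_threshold m k) md).
Qed.

Lemma cross_sectionP x : cubeOmega R x ->
  [/\ square (cross_section x), `|axis x| < 2^-1 & 0 < depth x].
Proof.
move=> [/= hn hb hd]; split => //.
  by split; rewrite /side /= in_itv /= -ler_norml ltW.
by rewrite /depth /edge_depth /= lt_min !subr_gt0 hn.
Qed.

Lemma depth_le x : depth x <= 2^-1.
Proof. by rewrite /depth /edge_depth ge_min gerBl normr_ge0. Qed.

Lemma fold_wave_le_tent c k (y : R) : fold_wave c k y <= 2^-1 - `|y|.
Proof. by elim: k => [|k IH] //=; rewrite ge_min IH. Qed.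

Lemma profile_off x : ~ cubeOmega R x -> profile x = 0.
Proof.
move=> nx; apply/max_idPl; rewrite ge_min; apply/orP.
have [ay|ay] := ltP `|axis x| 2^-1; last first.
  by left; rewrite (le_trans (fold_wave_le_tent _ _ _))// subr_le0.
right; rewrite leNgt; apply/negP => d0; apply: nx.
by move: d0; rewrite /depth /edge_depth /= lt_min !subr_gt0 => /andP[].
Qed.

Lemma profile_on x : cubeOmega R x ->
  profile x = Num.min (wave m n (axis x) (depth x)) (depth x).
Proof.
move=> /cross_sectionP[_ ay d0]; apply/max_idPr.
by rewrite le_min wave_ge0 ?ltW.
Qed.

Lemma profile_wave x : cubeOmega R x -> (0 < n)%N -> layer_depth m n <= depth x ->
  profile x = wave m n (axis x) (depth x).
Proof.
move=> Ox n0 dn; rewrite profile_on// min_l// wave_le//.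
  by apply: slope_le1; rewrite prednK.
by case: (cross_sectionP Ox) => _ _ /ltW.
Qed.

Lemma inv_sqrt_entry (k c : R) : 0 < k -> c ^+ 2 <= k -> `|(Num.sqrt k)^-1 * c| <= 1.
Proof.
move=> k0 ck; rewrite normrM normfV (ger0_norm (sqrtr_ge0 k)) ler_pdivrMl ?sqrtr_gt0//.
by rewrite mulr1 -sqrtr_sqr ler_sqrt// ltW.
Qed.

Lemma frame_entries j : [/\ `|vn R j 0| <= 1, `|vb32 R j 0| <= 1 & `|vd R j 0| <= 1].
Proof.
by split; rewrite mxE; apply: inv_sqrt_entry => //; elim/forall_I3: j; rewrite vec3E; lra.
Qed.

Lemma dot_step x h j v : dot (x + h *: e_ j) v - dot x v = h * v j 0.
Proof.
rewrite dotDl dotZl addrAC subrr add0r; congr (_ * _).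
rewrite /dot (bigD1 j)//= big1 ?addr0 ?mxE ?eqxx ?mul1r// => i ij.
by rewrite mxE (negbTE ij) mul0r.
Qed.

Lemma dot_step_le x h j v : 0 <= h -> `|v j 0| <= 1 ->
  `|dot (x + h *: e_ j) v - dot x v| <= h.
Proof. by move=> h0 v1; rewrite dot_step normrM ger0_norm// ler_piMr. Qed.

Lemma axis_step_le x h j : 0 <= h -> `|axis (x + h *: e_ j) - axis x| <= h.
Proof. by move=> h0; apply: dot_step_le => //; case: (frame_entries j). Qed.

Lemma depth_step_le x h j : 0 <= h -> `|depth (x + h *: e_ j) - depth x| <= h.
Proof.
move=> h0; have [n1 _ d1] := frame_entries j.
have gap v : `|v j 0| <= 1 ->
    `|(2^-1 - `|dot (x + h *: e_ j) v|) - (2^-1 - `|dot x v|)| <= h.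
  move=> v1; rewrite opprB addrC addrA addrNK distrC.
  exact: le_trans (ler_dist_dist _ _) (dot_step_le _ h0 v1).
by apply: min_lip; exact: gap.
Qed.

Lemma phase_step x h j : cubeOmega R x -> 0 <= h ->
  ~ critical m n h (cross_section x, axis x) -> depth x < layer_depth m 0 ->
  phase (x + h *: e_ j) = phase x.
Proof.
move=> Ox h0 nc d0; have [sq /ltW ay _] := cross_sectionP Ox.
have nb := not_critical sq ay nc.
have [dn|[i i_n /andP[di1 di2]]] := layer_cases n d0.
  exact: (wave_increment_bottom nb (axis_step_le x j h0) (depth_step_le x j h0) (ltW dn)).1.
exact: (wave_increment slope_le1 nb (axis_step_le x j h0) (depth_step_le x j h0) i_n di1
  (ltW di2)).1.
Qed.

Lemma profile_step x h j i : cubeOmega R x -> cubeOmega R (x + h *: e_ j) -> 0 <= h ->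
  ~ critical m n h (cross_section x, axis x) ->
  (i < n)%N -> layer_depth m i.+1 <= depth x -> depth x <= layer_depth m i ->
  `|profile (x + h *: e_ j) - profile x - phase x * (h * vb32 R j 0)| <= 2 * fold_slope m i * h.
Proof.
move=> Ox Ox' h0 nc i_n di1 di; have [sq /ltW ay _] := cross_sectionP Ox.
have nb := not_critical sq ay nc.
have dn : layer_depth m n <= depth x by rewrite (le_trans _ di1)// layer_depth_mono.
have dn' := (far_depth nb (leqnn n) (depth_step_le x j h0)).2 dn.
have n0 : (0 < n)%N by exact: leq_ltn_trans i_n.
rewrite !profile_wave// -(dot_step x h j).
exact: (wave_increment slope_le1 nb (axis_step_le x j h0) (depth_step_le x j h0) i_n di1 di).2.
Qed.

Lemma profile_step_bottom x h j : cubeOmega R x -> cubeOmega R (x + h *: e_ j) -> 0 <= h ->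
  ~ critical m n h (cross_section x, axis x) -> depth x <= layer_depth m n ->
  `|profile (x + h *: e_ j) - profile x| <= h.
Proof.
move=> Ox Ox' h0 nc dn; have [sq /ltW ay _] := cross_sectionP Ox.
have nb := not_critical sq ay nc.
rewrite !profile_on//; apply: min_lip; last exact: depth_step_le.
exact: (wave_increment_bottom nb (axis_step_le x j h0) (depth_step_le x j h0) dn).2.
Qed.

End Profile.

Section Slopes.
Context {R : realType}.
Variables m n : nat.
Hypothesis slope_le1 : forall i, (i < n)%N -> fold_slope m i <= 1 :> R.
Implicit Types (x y v : 'cV[R]_3) (h : R) (j : 'I_3).
Notation e_ j := (delta_mx j 0 : 'cV[R]_3).
Notation step k := (k.+1%:R^-1 : R).

Lemma critical_mono h h' : h <= h' -> critical m n h `<=` critical m n h'.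
Proof.
move=> hh' [q y]; rewrite /critical -!(bigcup_mkord _ (layer_wall m _)) -!(bigcup_mkord _
  (fold_wall m _)).
move=> [[[sq yh]|[j jn [[sq dj] sy]]]|[j jn [rj tj]]].
- by left; left; split => //; exact: le_trans hh'.
- by left; right; exists j => //; split => //; split => //; exact: le_trans hh'.
- right; exists j => //; split => //=; apply: le_trans tj _.
  by rewrite ler_pM2l.
Qed.

(** Since critical sets decrease with the step length (critical_mono), a point
    outside this null set is not critical for any short step. *)
Definition exceptional : set (coords3 R) := \bigcap_k critical m n (step k).

Lemma measurable_exceptional : measurable exceptional.
Proof. by apply: bigcapT_measurable => k; exact: measurable_critical. Qed.

Lemma exceptional_null : lebesgue3 exceptional = 0%E.
Proof.
apply/eqP; rewrite eq_le measure_ge0 andbT.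
have le k : (lebesgue3 exceptional <= ((2 + 8 * n.+1%:R + 104 * 2 ^+ m) * step k)%:E)%E.
  apply: le_trans (critical_measure m n _); last by rewrite invr_ge0.
  apply: le_measure; rewrite ?inE.
  - exact: measurable_exceptional.
  - exact: measurable_critical.
  - by move=> z; apply.
apply/lee_addgt0Pr => e e0; rewrite add0e.
set C := 2 + _ + _ in le; have C0 : 0 < C.
  by rewrite /C -addrA ltr_wpDr// addr_ge0 ?mulr_ge0// exprn_ge0.
have [k _ /(_ k (leqnn k)) /= ke] := near_infty_natSinv_lt (PosNum (divr_gt0 e0 C0)).
apply: (le_trans (le k)); rewrite lee_fin mulrC -ler_pdivlMr//.
exact: ltW.
Qed.

Lemma eventually_not_critical p : ~ exceptional p ->
  \forall k \near \oo, ~ critical m n (step k) p.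
Proof.
move=> /asboolPn; rewrite /exceptional => ne.
have [k0 nk0] : exists k0, ~ critical m n (step k0) p.
  apply: contrapT => /forallNP h; apply: (elimN (asboolP _) ne) => k _.
  by apply: contrapT; exact: h.
exists k0 => // k /= k0k cr; apply: nk0; apply: (critical_mono _ cr).
by rewrite lef_pV2 ?posrE// ler_nat.
Qed.

Lemma eventually_in_cube x j : cubeOmega R x ->
  \forall k \near \oo, cubeOmega R (x + step k *: e_ j).
Proof.
move=> [/= hn hb hd]; have [n1 b1 d1] := frame_entries (R := R) j.
have gap v : `|dot x v| < 2^-1 -> `|v j 0| <= 1 ->
    \forall k \near \oo, `|dot (x + step k *: e_ j) v| < 2^-1.
  move=> xv v1.
  have g0 : 0 < 2^-1 - `|dot x v| by rewrite subr_gt0.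
  apply: filterS (near_infty_natSinv_lt (PosNum g0)) => k /= kg.
  have s0 : 0 <= step k by rewrite invr_ge0.
  have h2 := dot_step_le x s0 v1.
  rewrite -[X in `|X| < _](subrK (dot x v)) (le_lt_trans (ler_normD _ _))//.
  by rewrite -ltrBrDr; exact: le_lt_trans kg.
have := gap _ hn n1; have := gap _ hb b1; have := gap _ hd d1.
by apply: filterS3 => k h1 h2 h3; split.
Qed.

Notation slope := (ray_slope (profile (R := R) m n)).

(** An estimate on the increments over all short steps passes to the slope. *)
Lemma slope_near x j (c r : R) :
  (\forall k \near \oo, `|profile m n (x + step k *: e_ j) - profile m n x - c * step k|
    <= r * step k) ->
  `|slope j x - c| <= r.
Proof.
move=> hq.
have cq : (fun k => `|k.+1%:R * (profile m n (x + step k *: e_ j) - profile m n x) - c|) @ \oo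
    --> `|slope j x - c|.
  apply: cvg_norm; apply: cvgB; last exact: cvg_cst.
  exact: ray_slope_cvg (polyhedral_profile m n).
rewrite -(cvg_lim (@Rhausdorff _) cq); apply: limr_le.
  by apply/cvg_ex; eexists; exact: cq.
apply: filterS hq => k hk /=.
have k0 : 0 < k.+1%:R :> R by [].
have -> : k.+1%:R * (profile m n (x + step k *: e_ j) - profile m n x) - c =
   k.+1%:R * (profile m n (x + step k *: e_ j) - profile m n x - c * step k).
  by rewrite [RHS]mulrBr [in RHS](mulrCA _ c) mulfV ?mulr1// gt_eqF.
by rewrite normrM (gtr0_norm k0) mulrC -ler_pdivlMr.
Qed.

Lemma slope_layer x j i : cubeOmega R x -> ~ exceptional (cross_section x, axis x) ->
  (i < n)%N -> layer_depth m i.+1 <= depth x -> depth x <= layer_depth m i ->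
  `|slope j x - phase m n x * vb32 R j 0| <= 2 * fold_slope m i.
Proof.
move=> Ox ne i_n di1 di; apply: slope_near.
apply: filterS2 (eventually_not_critical ne) (eventually_in_cube j Ox) => k nc Ox'.
have s0 : 0 <= step k by rewrite invr_ge0.
by rewrite -mulrA [vb32 R j 0 * _]mulrC; exact: profile_step.
Qed.

Lemma slope_bottom x j : cubeOmega R x -> ~ exceptional (cross_section x, axis x) ->
  depth x <= layer_depth m n -> `|slope j x - 0| <= 1.
Proof.
move=> Ox ne dn; apply: slope_near.
apply: filterS2 (eventually_not_critical ne) (eventually_in_cube j Ox) => k nc Ox'.
have s0 : 0 <= step k by rewrite invr_ge0.
by rewrite mul0r subr0 mul1r; exact: profile_step_bottom.
Qed.

End Slopes.

(** * The energy of the construction *)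

Section Energy.
Context {R : realType}.
Variables m n : nat.
Hypothesis slope_le1 : forall i, (i < n)%N -> fold_slope m i <= 1 :> R.
Implicit Types (x y v : 'cV[R]_3) (h : R) (j : 'I_3).
Notation e_ j := (delta_mx j 0 : 'cV[R]_3).
Notation slope := (ray_slope (profile (R := R) m n)).

(** The vector b23, the second normal of the twin; it lies in the span of n and d. *)
Definition shear_dir : 'cV[R]_3 := (Num.sqrt 2)^-1 *: vec3 0 1 1.

(** The matrix e^(2) - F = F - e^(3), the symmetric part of 3 shear_dir b32^t: see
    twinE. *)
Definition twin : 'M[R]_3 := diag3 0 (- (3 / 2)) (3 / 2).

Definition displacement x : 'cV[R]_3 :=
  Fhalf R *m x + (3 * profile m n x) *: shear_dir.
Definition gradient x : 'M[R]_3 :=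
  Fhalf R + 3 *: (shear_dir *m (\row_j slope j x)).
Definition strain x : 'M[R]_3 := Fhalf R + phase m n x *: twin.

Lemma inv_sqrt2 : (Num.sqrt 2)^-1 ^+ 2 = 2^-1 :> R.
Proof. by rewrite exprVn sqr_sqrtr. Qed.

Lemma shear_dirE : (shear_dir 0 0 = 0) * (shear_dir 1 0 = (Num.sqrt 2)^-1) *
  (shear_dir 2 0 = (Num.sqrt 2)^-1).
Proof. by rewrite !mxE /= mulr0 mulr1. Qed.

Lemma shear_dir_le1 i : `|shear_dir i 0| <= 1.
Proof. by rewrite mxE; apply: inv_sqrt_entry => //; elim/forall_I3: i; rewrite vec3E; lra. Qed.

Lemma diag3E (a b c : R) i k : diag3 a b c i k = (vec3 a b c i 0) *+ (i == k).
Proof. by rewrite !mxE. Qed.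

Lemma twinE i k : 3 / 2 * (shear_dir i 0 * vb32 R k 0 + shear_dir k 0 * vb32 R i 0) = twin i k.
Proof.
rewrite /twin diag3E.
have bE : (vb32 R 0 0 = 0) * (vb32 R 1 0 = - (Num.sqrt 2)^-1) * (vb32 R 2 0 = (Num.sqrt 2)^-1).
  by rewrite !mxE /= mulr0 mulr1 mulrN1.
by elim/forall_I3: i; elim/forall_I3: k;
  rewrite ?vec3E ?shear_dirE ?bE ?eqxx /= ?mulr0n ?mulr1n;
  move: inv_sqrt2; rewrite expr2; move: (Num.sqrt 2)^-1 => s s2; nra.
Qed.

Lemma gradientE x i k : gradient x i k = Fhalf R i k + 3 * (shear_dir i 0 * slope k x).
Proof.
rewrite /gradient mxE; congr (_ + _); rewrite mxE; congr (_ * _).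
by rewrite mxE big_ord1; congr (_ * _); rewrite mxE.
Qed.

Lemma strainE x i k : strain x i k = Fhalf R i k + phase m n x * twin i k.
Proof. by rewrite /strain mxE; congr (_ + _); rewrite mxE. Qed.

Lemma sym_partE (M : 'M[R]_3) i k : sym_part M i k = 2^-1 * (M i k + M k i).
Proof. by rewrite /sym_part mxE; congr (_ * _); rewrite mxE; congr (_ + _); rewrite mxE. Qed.

(** The choice of the twin cancels the part phase * b32 of the slope, and only the
    deviation from it contributes to the elastic energy. *)
Lemma strain_error_entry x i k : (sym_part (gradient x) - strain x) i k =
  3 / 2 * (shear_dir i 0 * (slope k x - phase m n x * vb32 R k 0) +
           shear_dir k 0 * (slope i x - phase m n x * vb32 R i 0)).
Proof.
have FT : Fhalf R k i = Fhalf R i k.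
  by rewrite !mxE; case: eqVneq => [->|ki] //; rewrite eq_sym (negbTE ki).
rewrite mxE sym_partE [X in _ + X]mxE !gradientE strainE -twinE.
rewrite FT.
by field.
Qed.

Lemma strain_error_le x (r : R) :
  (forall j, `|slope j x - phase m n x * vb32 R j 0| <= r) ->
  sqnorm (sym_part (gradient x) - strain x) <= 81 * r ^+ 2.
Proof.
move=> hr; have r0 : 0 <= r by exact: le_trans (hr 0).
have entry i k : (sym_part (gradient x) - strain x) i k ^+ 2 <= 9 * r ^+ 2.
  rewrite (_ : 9 * r ^+ 2 = (3 * r) ^+ 2); last by ring.
  rewrite -real_normK ?num_real// ler_sqr ?nnegrE ?mulr_ge0//.
  rewrite strain_error_entry normrM ger0_norm//.
  have term a b : `|shear_dir a 0 * (slope b x - phase m n x * vb32 R b 0)| <= r.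
    by rewrite normrM -[leRHS]mul1r ler_pM// shear_dir_le1.
  have := ler_normD (shear_dir i 0 * (slope k x - phase m n x * vb32 R k 0))
    (shear_dir k 0 * (slope i x - phase m n x * vb32 R i 0)).
  have := term i k; have := term k i.
  set A := `| _ + _|; lra.
rewrite /sqnorm !sum_I3.
have := entry 0 0; have := entry 0 1; have := entry 0 2.
have := entry 1 0; have := entry 1 1; have := entry 1 2.
have := entry 2 0; have := entry 2 1; have := entry 2 2.
set A := _ - _; lra.
Qed.

Definition layer i : set (coords3 R) :=
  (rim m i `&` [set q | layer_depth m i.+1 <= edge_depth q]) `*` side.
Definition bottom_layer : set (coords3 R) := rim m n `*` side.

Lemma measurable_layer i : measurable (layer i).
Proof.
apply: measurableX; last exact: measurable_side.
apply: measurableI; first exact: measurable_rim.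
have := measurable_fun_ler (measurable_cst (layer_depth m i.+1)) (@measurable_edge_depth R).
by move=> /(_ measurableT [set true]); rewrite setTI; exact.
Qed.

Lemma measurable_bottom : measurable bottom_layer.
Proof. by apply: measurableX; [exact: measurable_rim|exact: measurable_side]. Qed.

Lemma bottom_measure : (lebesgue3 bottom_layer <= (4 * layer_depth m n)%:E)%E.
Proof.
rewrite lebesgue3X ?side_measure ?mule1; [exact: rim_le|exact: measurable_rim|exact:
  measurable_side].
Qed.

(** The depth in the cube is less than 1 = layer_depth m m, so the layers of index
    less than m are empty. *)
Definition layer_volume i : R := if (i < m)%N then 0 else 4 * layer_depth m i.

Lemma layer_measure i : (lebesgue3 (layer i) <= (layer_volume i)%:E)%E.
Proof.
rewrite /layer_volume; case: ifPn => im.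
  rewrite (_ : layer i = set0) ?measure0//.
  rewrite -subset0 => -[q y] [[_ /= dq] _].
  have d1 : layer_depth m m = 1 :> R by rewrite /layer_depth divff// expf_neq0.
  have := layer_depth_mono (R := R) m im; rewrite d1 => d2.
  have : edge_depth q <= 2^-1 by rewrite /edge_depth ge_min gerBl normr_ge0.
  lra.
apply: (@le_trans _ _ (lebesgue3 (rim m i `*` side))).
  apply: le_measure; rewrite ?inE.
  - exact: measurable_layer.
  - by apply: measurableX; [exact: measurable_rim|exact: measurable_side].
  - by move=> [q y] [[]].
rewrite lebesgue3X ?side_measure ?mule1; [exact: rim_le|exact: measurable_rim|exact:
  measurable_side].
Qed.

(** The squared slope times the thickness of the layers has ratio 3/4. *)
Lemma sum_layer_energy k :
  \sum_(i < k) fold_slope m i ^+ 2 * layer_volume i <= 9 * (4 ^+ m)^-1.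
Proof.
have E0 l : (l <= m)%N -> \sum_(i < l) fold_slope m i ^+ 2 * layer_volume i = 0.
  move=> lm; apply: big1 => i _; rewrite /layer_volume.
  by rewrite (leq_trans (ltn_ord i) lm) mulr0.
have [km|/ltnW mk] := leqP k m; first by rewrite E0// mulr_ge0// invr_ge0 exprn_ge0.
rewrite -(subnKC mk); move: (k - m)%N => l {mk k}.
apply: (@le_trans _ _ (9 * (4 ^+ m)^-1 * (1 - (3 / 4) ^+ l))); last first.
  rewrite ler_piMr ?mulr_ge0 ?invr_ge0 ?exprn_ge0// gerBl exprn_ge0//.
elim: l => [|l IH]; first by rewrite addn0 E0// expr0 subrr mulr0.
rewrite addnS big_ord_recr /= [X in _ + _ * X]/layer_volume ltnNge leq_addr /=.
have -> : fold_slope m (m + l) ^+ 2 * (4 * layer_depth m (m + l)) =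
    9 / 4 * (4 ^+ m)^-1 * (3 / 4) ^+ l :> R.
  rewrite /fold_slope /layer_depth /fold_level.
  rewrite [3 ^+ (m + l).+1]exprS [2 ^+ (m + l).+2]exprS [2 ^+ (m + l).+1]exprS !exprD [(3
    / 4) ^+ l]expr_div_n.
  have -> : 4 ^+ m = (2 ^+ m) ^+ 2 :> R by rewrite -exprM mulnC exprM; congr (_ ^+ _); ring.
  have -> : 4 ^+ l = (2 ^+ l) ^+ 2 :> R by rewrite -exprM mulnC exprM; congr (_ ^+ _); ring.
  by field; rewrite !expf_neq0.
by rewrite [(3 / 4) ^+ l.+1]exprS; lra.
Qed.

End Energy.

Section EnergyBounds.
Context {R : realType}.
Variables m n : nat.
Hypothesis slope_le1 : forall i, (i < n)%N -> fold_slope m i <= 1 :> R.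
Implicit Types (x y v : 'cV[R]_3) (h : R) (j : 'I_3).
Notation e_ j := (delta_mx j 0 : 'cV[R]_3).
Notation slope := (ray_slope (profile (R := R) m n)).
Notation u := (displacement (R := R) m n).
Notation Du := (gradient (R := R) m n).
Notation chi := (strain (R := R) m n).

Lemma measurable_cube : measurable_set3 (cubeOmega R).
Proof.
have mlt v : measurable_set3 [set x | `|dot x v| < 2^-1].
  apply: measurable3P; apply: measurable_fun_ltr => //.
  exact: (measurableT_comp (@normr_measurable R setT) (measurable3_dot v)).
rewrite (_ : cubeOmega R = [set x | `|dot x (vn R)| < 2^-1] `&`
  [set x | `|dot x (vb32 R)| < 2^-1] `&` [set x | `|dot x (vd R)| < 2^-1]).
  by apply: measurableI; [apply: measurableI|]; exact: mlt.
by apply/seteqP; split=> x [] // [].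
Qed.

Lemma cube_measure : (lebesgue3 (@of_coords R @^-1` cubeOmega R) <= 1)%E.
Proof.
have mS : measurable (@square R `*` @side R).
  by apply: measurableX; [exact: measurable_square|exact: measurable_side].
have <- : lebesgue3 (@square R `*` @side R) = 1%E.
  by rewrite lebesgue3X ?side_measure ?mule1 ?square_measure//;
    [exact: measurable_square|exact: measurable_side].
rewrite -(lebesgue3_rotate mS); apply: le_measure; rewrite ?inE.
- exact: measurable_cube.
- by rewrite -[X in measurable X]setTI; exact: measurable_rotate.
move=> p /= /cross_sectionP[sq /ltW ay _]; split => //.
by rewrite /side /= in_itv /= -ler_norml.
Qed.

Lemma depth_lt_top x : depth x < layer_depth m 0.
Proof.
apply: (le_lt_trans (depth_le x)); rewrite /layer_depth expr0 divr1.
by rewrite (@lt_le_trans _ _ 1)// ?exprn_ege1// ?ler1n//; lra.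
Qed.

Lemma measurable_sum3 (F : 'I_3 -> 'cV[R]_3 -> R) :
  (forall i, measurable3 setT (F i)) -> measurable3 setT (fun x => \sum_i F i x).
Proof.
move=> mF; under [X in measurable3 _ X]eq_fun do rewrite sum_I3.
by apply: measurable_funD; [apply: measurable_funD|]; exact: mF.
Qed.

Lemma measurable_gradient i k : measurable3 setT (fun x => Du x i k).
Proof.
under [X in measurable3 _ X]eq_fun do rewrite gradientE.
have ms := measurable_ray_slope k (polyhedral_profile (R := R) m n).
have mp := measurable3M (measurable3_cst 3) (measurable3M (measurable3_cst (shear_dir i 0)) ms).
exact: measurable_funD (measurable3_cst _) mp.
Qed.

Lemma measurable_strain i k : measurable3 setT (fun x => chi x i k).
Proof.
under [X in measurable3 _ X]eq_fun do rewrite strainE.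
have mp := measurable3M (@measurable_phase R m n) (measurable3_cst (twin i k)).
exact: measurable_funD (measurable3_cst _) mp.
Qed.

Lemma measurable_density : measurable3 setT (fun x => sqnorm (sym_part (Du x) - chi x)).
Proof.
apply: measurable_sum3 => i; apply: measurable_sum3 => k.
apply: (measurable_funX (f := (fun x => (sym_part (Du x) - chi x) i k) \o @of_coords R)).
rewrite (_ : _ \o _ = (fun x => 2^-1 * (Du x i k + Du x k i) - chi x i k) \o @of_coords R).
  apply: measurable_funB; last exact: measurable_strain.
  apply: measurable_funM => //.
  by apply: measurable_funD; exact: measurable_gradient.
by apply/funext => p /=; rewrite mxE sym_partE [X in _ + X]mxE.
Qed.

Lemma sqnorm_ge0 k l (A : 'M[R]_(k, l)) : 0 <= sqnorm A.
Proof. by apply: sumr_ge0 => i _; apply: sumr_ge0 => j _; exact: sqr_ge0. Qed.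

(** The deviation of the slopes is at most 2 fold_slope in a layer, by
    slope_layer, and at most 1 + 1 in the bottom layer, by slope_bottom; in both
    cases strain_error_le gives 81 * 2^2 = 324. *)
Definition density_bound (p : coords3 R) : R :=
  \sum_(i < n) 324 * fold_slope m i ^+ 2 * \1_(layer m i) (rotate p) +
  324 * \1_(bottom_layer m n) (rotate p).

Lemma density_le p : cubeOmega R (of_coords p) -> ~ exceptional m n (rotate p) ->
  sqnorm (sym_part (Du (of_coords p)) - chi (of_coords p)) <= density_bound p.
Proof.
move=> Op ne; set x := of_coords p in Op *.
have K0 : 0 <= 324 :> R := ler0n R 324.
have rE : rotate p = (cross_section x, axis x) by [].
have [sq /ltW ay d0] := cross_sectionP Op.
have sy : @side R (axis x) by rewrite /side /= in_itv /= -ler_norml.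
have pos i : 0 <= 324 * fold_slope m i ^+ 2 * \1_(layer m i) (rotate p) :> R.
  rewrite indicE; exact: mulr_ge0 (mulr_ge0 K0 (sqr_ge0 _)) (ler0n _ _).
have [dn|[i i_n /andP[di1 di2]]] := layer_cases n (depth_lt_top x).
  apply: (@le_trans _ _ (81 * 2 ^+ 2)).
    apply: strain_error_le => j.
    have := slope_bottom j Op ne (ltW dn); rewrite subr0 => s1.
    rewrite (le_trans (ler_normB _ _))// (_ : 2 = 1 + 1)// lerD//.
    rewrite normrM; have [_ b1 _] := frame_entries (R := R) j.
    rewrite -[leRHS]mul1r ler_pM//.
    by case: (fold_sign_pm1 (threshold m (depth x)) n (axis x)) => E;
      rewrite /phase /wave_sign E ?normrN normr1.
  rewrite /density_bound; have -> : \1_(bottom_layer m n) (rotate p) = 1 :> R.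
    rewrite indicE mem_set//; rewrite rE; split => //.
    by split => //; exact: ltW.
  rewrite (_ : 81 * 2 ^+ 2 = 324 * 1); last by ring.
  by rewrite lerDr sumr_ge0.
apply: (@le_trans _ _ (81 * (2 * fold_slope m i) ^+ 2)).
  by apply: strain_error_le => j; exact: (slope_layer slope_le1 j Op ne i_n di1 (ltW di2)).
rewrite /density_bound (bigD1 (Ordinal i_n))//=.
have -> : \1_(layer m i) (rotate p) = 1 :> R.
  rewrite indicE mem_set//; rewrite rE; split => //.
  by split => //; split => //; exact: ltW.
rewrite mulr1 (_ : 81 * _ = 324 * fold_slope m i ^+ 2); last by ring.
rewrite -addrA lerDl; apply: addr_ge0; first by apply: sumr_ge0.
rewrite indicE; exact: mulr_ge0 K0 (ler0n _ _).
Qed.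

Lemma measurable_rotate_preimage (A : set (coords3 R)) : measurable A ->
  measurable (@rotate R @^-1` A).
Proof. by move=> mA; rewrite -[X in measurable X]setTI; exact: measurable_rotate. Qed.

Lemma measurable_rotate_indic (A : set (coords3 R)) (c : R) : measurable A ->
  measurable_fun setT (fun p => c * \1_A (rotate p)).
Proof.
move=> mA; apply: (@measurable_funM _ _ _ setT (cst c) (\1_(@rotate R @^-1` A))) => //.
by apply: measurable_indic; exact: measurable_rotate_preimage.
Qed.

Lemma integral_rotate_indic (A : set (coords3 R)) (c : R) : 0 <= c -> measurable A ->
  (\int[@lebesgue3 R]_p (c * \1_A (rotate p))%:E = c%:E * lebesgue3 A)%E.
Proof.
move=> c0 mA; have mrA := measurable_rotate_preimage mA.
rewrite -(lebesgue3_rotate mA) -[in RHS](setIT (_ @^-1` A)) -integral_indic// -ge0_integralZl//.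
by apply/measurable_EFinP; exact: measurable_indic.
Qed.

Lemma elastic_le : (elastic_energy (cubeOmega R) Du chi <=
  (2916 * (4 ^+ m)^-1 + 1296 * layer_depth m n)%:E)%E.
Proof.
have K0 : 0 <= 324 :> R := ler0n R 324.
have K1 : 0 < 324 :> R by rewrite ltr0n.
have mB : measurable_fun setT (EFin \o density_bound).
  apply/measurable_EFinP; apply: measurable_funD.
    by apply: measurable_sum => i; exact: measurable_rotate_indic (measurable_layer _ _).
  exact: measurable_rotate_indic (measurable_bottom _ _).
have B0 p : 0 <= density_bound p.
  apply: addr_ge0; last by rewrite indicE; exact: mulr_ge0 K0 (ler0n _ _).
  by apply: sumr_ge0 => i _; rewrite indicE; exact: mulr_ge0 (mulr_ge0 K0 (sqr_ge0 _))
    (ler0n _ _).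
have mC := measurable_cube.
apply: (@le_trans _ _ (\int[@lebesgue3 R]_p (density_bound p)%:E)%E).
  apply: (@le_trans _ _ (\int[@lebesgue3 R]_(p in @of_coords R @^-1` cubeOmega R)
    (density_bound p)%:E)%E).
    apply: ae_ge0_le_integral => //.
    - by move=> p _; rewrite lee_fin sqnorm_ge0.
    - by apply: measurable_funTS; apply/measurable_EFinP; exact: measurable_density.
    - by move=> p _; rewrite lee_fin.
    - exact: measurable_funTS.
    have mrE := measurable_rotate_preimage (measurable_exceptional m n).
    exists (@rotate R @^-1` exceptional m n); split => //.
      apply: (eq_trans (lebesgue3_rotate (measurable_exceptional m n))); exact:
        exceptional_null.
    move=> p /= np; apply: contrapT => ne; apply: np => Op.
    by rewrite lee_fin; exact: density_le.
  by apply: ge0_subset_integral => // p _; rewrite lee_fin.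
rewrite /density_bound; under eq_integral do rewrite EFinD -sumEFin.
have c0 i : 0 <= 324 * fold_slope m i ^+ 2 :> R by apply: mulr_ge0 => //; exact: sqr_ge0.
have ml i : measurable_fun setT (fun p : coords3 R => (324 * fold_slope m i ^+ 2 *
  \1_(layer m i) (rotate p) : R)%:E).
  exact: (measurable_EFinP _ _).2 (measurable_rotate_indic (324 * fold_slope m i ^+ 2)
    (measurable_layer m i)).
have ge0 i (p : coords3 R) : (0 <= (324 * fold_slope m i ^+ 2 * \1_(layer m i) (rotate p)
  : R)%:E)%E.
  by rewrite lee_fin; apply: mulr_ge0.
rewrite ge0_integralD; first last.
- exact: (measurable_EFinP _ _).2 (measurable_rotate_indic 324 (measurable_bottom m n)).
- by move=> p _; rewrite lee_fin indicE; exact: mulr_ge0 K0 (ler0n _ _).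
- by apply: emeasurable_sum.
- by move=> p _; apply: sume_ge0.
- exact: measurableT.
rewrite ge0_integral_sum// EFinD; apply: leeD.
  apply: (@le_trans _ _ (\sum_(i < n) (324 * (fold_slope m i ^+ 2 * layer_volume m i))%:E)%E).
    apply: lee_sum => i _; rewrite integral_rotate_indic//; last exact: measurable_layer.
    rewrite [leRHS](_ : _ = ((324 * fold_slope m i ^+ 2)%:E * (layer_volume m i)%:E)%E);
      last by rewrite -EFinM mulrA.
    by apply: lee_wpmul2l; [rewrite lee_fin|exact: layer_measure].
  rewrite sumEFin lee_fin -mulr_sumr (_ : 2916 * _ = 324 * (9 * (4 ^+ m)^-1)); last by ring.
  by rewrite ler_pM2l// sum_layer_energy.
rewrite integral_rotate_indic//; last exact: measurable_bottom.
rewrite (_ : 1296 * _ = 324 * (4 * layer_depth m n)); last by ring.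
by rewrite EFinM; apply: lee_wpmul2l; [rewrite lee_fin|exact: bottom_measure].
Qed.

End EnergyBounds.

(** * Admissibility *)

Section Admissibility.
Context {R : realType}.
Implicit Types (x y v : 'cV[R]_3) (h : R).
Notation e_ j := (delta_mx j 0 : 'cV[R]_3).

Lemma locally_bounded_cst (c : R) : locally_bounded (fun _ : 'cV[R]_3 => c).
Proof. by move=> M; exists `|c|. Qed.

Lemma locally_boundedD (f g : 'cV[R]_3 -> R) :
  locally_bounded f -> locally_bounded g -> locally_bounded (fun x => f x + g x).
Proof.
move=> bf bg M; have [B hB] := bf M; have [C hC] := bg M; exists (B + C) => x xM.
by rewrite (le_trans (ler_normD _ _))// lerD ?hB ?hC.
Qed.

Lemma locally_bounded_sum (I : Type) (s : seq I) (F : I -> 'cV[R]_3 -> R) :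
  (forall i, locally_bounded (F i)) -> locally_bounded (fun x => \sum_(i <- s) F i x).
Proof.
move=> bF; elim: s => [|i s IH].
  by under eq_fun do rewrite big_nil; exact: locally_bounded_cst.
by under eq_fun do rewrite big_cons; exact: locally_boundedD.
Qed.

Lemma locally_boundedX (f : 'cV[R]_3 -> R) :
  locally_bounded f -> locally_bounded (fun x => f x ^+ 2).
Proof.
move=> bf M; have [B hB] := bf M; exists (B ^+ 2) => x xM.
rewrite normrX ler_sqr ?nnegrE ?hB//.
exact: le_trans (hB x xM).
Qed.

Lemma L2loc_locally_bounded k l (f : 'cV[R]_3 -> 'M[R]_(k, l)) :
  (forall i j, measurable3 setT (fun x => f x i j)) ->
  (forall i j, locally_bounded (fun x => f x i j)) -> L2loc f.
Proof.
move=> mf bf; split => // A cA.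
have bsq : locally_bounded (fun x => sqnorm (f x)).
  apply: locally_bounded_sum => i; apply: locally_bounded_sum => j.
  exact: locally_boundedX.
have msq : measurable_fun setT ((fun x => sqnorm (f x)) \o @of_coords R).
  apply: measurable_sum => i; apply: measurable_sum => j.
  exact: (measurable_funX 2 (mf i j)).
have [M0 [_ hM0]] := compact_bounded cA.
have AM : A `<=` box (`|M0| + 1).
  move=> x Ax; have : M0 < `|M0| + 1 by rewrite ltr_pwDr// ler_norm.
  by move=> /hM0/(_ x Ax).
have [B hB] := bsq (`|M0| + 1).
have mA := compact_measurable3 cA.
rewrite /integral3; apply: integrable_lty => //.
apply: (measurable_bounded_integrable (f := (fun x => sqnorm (f x)) \o @of_coords R)) => //.
- apply: (le_lt_trans _ (lebesgue3_box (`|M0| + 1))).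
  by apply: le_measure; rewrite ?inE//; [exact: measurable_box|move=> p; exact: AM].
- exact: measurable_funTS.
- exists B; split; [exact: num_real|move=> C BC p Ap /=].
  by rewrite (le_trans (hB _ (AM _ Ap)))// ltW.
Qed.

Lemma ray_slope_bounded (f : 'cV[R]_3 -> R) (j : 'I_3) : polyhedral f ->
  exists L, forall x, `|ray_slope f j x| <= L.
Proof.
move=> pf; have [_ [L L0 fL] _] := pf; exists L => x.
have /cvg_norm cq := ray_slope_cvg (j := j) (x := x) pf.
rewrite -(cvg_lim (@Rhausdorff _) cq); apply: limr_le.
  by apply/cvg_ex; eexists; exact: cq.
apply: nearW => k; rewrite normrM ger0_norm// -ler_pdivlMl//.
rewrite (le_trans (fL _ _))// addrC addKr mulrC ler_wpM2r//.
by rewrite normrZ ger0_norm ?invr_ge0// ler_piMr ?invr_ge0// norm_delta.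
Qed.

Section Displacement.
Variables m n : nat.
Notation u := (displacement (R := R) m n).
Notation Du := (gradient (R := R) m n).
Notation g := (profile (R := R) m n).

Lemma displacementE x i :
  u x i 0 = dot x (\col_k Fhalf R i k) + (3 * shear_dir i 0) * g x.
Proof.
rewrite /displacement mxE; congr (_ + _); last by rewrite mxE mulrAC.
by rewrite mxE /dot; apply: eq_bigr => k _; rewrite [X in _ = _ * X]mxE mulrC.
Qed.

Lemma polyhedral_displacement i : polyhedral (fun x => u x i 0).
Proof.
under [X in polyhedral X]eq_fun do rewrite displacementE.
apply: polyhedralD; first exact: polyhedral_dot.
exact: polyhedralZ (polyhedral_profile m n).
Qed.

Lemma displacement_slope x i (j : 'I_3) :
  (fun k => k.+1%:R * (u (x + k.+1%:R^-1 *: e_ j) i 0 - u x i 0)) @ \oo --> Du x i j.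
Proof.
rewrite gradientE.
have E k : Fhalf R i j + 3 * (shear_dir i 0 *
    (k.+1%:R * (g (x + k.+1%:R^-1 *: e_ j) - g x))) =
    k.+1%:R * (u (x + k.+1%:R^-1 *: e_ j) i 0 - u x i 0).
  rewrite !displacementE opprD addrACA dot_step [RHS]mulrDr.
  by congr (_ + _); [rewrite mulVKf ?pnatr_eq0// [RHS]mxE|ring].
rewrite -(funext E).
apply: cvgD; first exact: cvg_cst.
apply: cvgMr; apply: cvgMr.
exact: ray_slope_cvg (polyhedral_profile m n).
Qed.

Lemma displacement_admissible : admissible (cubeOmega R) (Fhalf R) u Du.
Proof.
split; last first.
  exists 0 => x nx; rewrite addr0 /displacement profile_off ?mulr0 ?scale0r ?addr0//.
  by move=> Ox; apply: nx; exact: subset_closure.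
split.
- apply: L2loc_locally_bounded => i j; rewrite ord1.
    by case: (polyhedral_displacement i).
  by have [_ [L _ /lipschitz_locally_bounded]] := polyhedral_displacement i.
- apply: L2loc_locally_bounded => i j; first exact: measurable_gradient.
  have [L hL] := ray_slope_bounded j (polyhedral_profile (R := R) m n).
  move=> M; exists (`|Fhalf R i j| + 3 * (`|shear_dir i 0| * L)) => x _.
  rewrite gradientE (le_trans (ler_normD _ _))// lerD2l normrM ger0_norm// ler_pM2l//.
  by rewrite normrM ler_wpM2l.
- move=> i j phi C1.
  have [mu [L L0 uL] _] := polyhedral_displacement i.
  apply: (weak_derivative mu _ L0 uL) => //.
    exact: measurable_gradient.
  by move=> x; exact: displacement_slope.
Qed.

Lemma displacement_lipschitz : [lipschitz u x | x in cubeOmega R].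
Proof.
have [[_ [L0 L00 h0] _] [_ [L1 L10 h1] _] [_ [L2 L20 h2] _]] :=
  And3 (polyhedral_displacement 0) (polyhedral_displacement 1) (polyhedral_displacement 2).
exists (L0 + L1 + L2); split; first exact: num_real.
move=> M LM [x y] _ /=; apply: norm_cV_le => i; rewrite mxE [X in _ + X]mxE.
have bnd L : L <= L0 + L1 + L2 -> L * `|x - y| <= M * `|x - y|.
  by move=> LL; rewrite ler_wpM2r// (le_trans LL)// ltW.
by elim/forall_I3: i; [apply: le_trans (h0 x y) _|apply: le_trans (h1 x y) _|apply:
  le_trans (h2 x y) _];
  apply: bnd; lra.
Qed.

End Displacement.
End Admissibility.

(** * Total variation and choice of the scales *)

Section TotalVariation.
Context {R : realType}.
Variables m n : nat.
Hypothesis slope_le1 : forall i, (i < n)%N -> fold_slope m i <= 1 :> R.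
Notation chi := (strain (R := R) m n).

Lemma strain_wells (x : 'cV[R]_3) : chi x = e2 R \/ chi x = e3 R.
Proof.
have FE i k : Fhalf R i k = 2^-1 * e2 R i k + 2^-1 * e3 R i k.
  by rewrite /Fhalf mxE; congr (_ + _); rewrite mxE.
have [p1|p1] := fold_sign_pm1 (threshold m (depth x)) n (axis x); [left|right];
  apply/matrixP => i k; rewrite strainE /phase /wave_sign p1 FE /twin !diag3E;
  elim/forall_I3: i; elim/forall_I3: k; rewrite ?vec3E /= ?mulr0n ?mulr1n; lra.
Qed.

Lemma strain_le2 (x : 'cV[R]_3) i k : `|chi x i k| <= 2.
Proof.
case: (strain_wells x) => ->; rewrite diag3E ler_norml;
  elim/forall_I3: i; elim/forall_I3: k; rewrite ?vec3E /= ?mulr0n ?mulr1n; lra.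
Qed.

(** The strain jumps where the phase does, and phase_step confines this to the
    critical sets; 108 = 54 * 2 with the bound 2 on the entries. *)
Lemma strain_variation : (variation3 (cubeOmega R) chi <=
  (108 * (2 + 8 * n.+1%:R + 104 * 2 ^+ m))%:E)%E.
Proof.
rewrite (_ : 108 * _ = 54 * 2 * (2 + 8 * n.+1%:R + 104 * 2 ^+ m)); last by ring.
apply: (variation3_le (bad := fun k => @rotate R @^-1` critical m n k.+1%:R^-1)).
- exact: measurable_strain.
- exact: strain_le2.
- by move=> k; apply: measurable_rotate_preimage; exact: measurable_critical.
- move=> k; rewrite lebesgue3_rotate; last exact: measurable_critical.
  by apply: critical_measure; rewrite invr_ge0.
- move=> k p j Op nc; rewrite /strain; congr (_ + _ *: _).
  by apply: phase_step => //; exact: depth_lt_top.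
Qed.

Lemma strain_BV : BV (cubeOmega R) [set e2 R; e3 R] chi.
Proof.
split.
- by move=> x _; exact: strain_wells.
- move=> i k; rewrite /integrable3.
  apply: (measurable_bounded_integrable (f := (fun x => chi x i k) \o @of_coords R)).
  + exact: measurable_cube.
  + by apply: (le_lt_trans cube_measure); rewrite ltry.
  + by apply: measurable_funTS; exact: measurable_strain.
  + exists 2; split; [exact: num_real|move=> C BC p Ap /=].
    by rewrite (le_trans (strain_le2 _ _ _))// ltW.
- by apply: (le_lt_trans strain_variation); rewrite ltry.
Qed.

End TotalVariation.

Section Scales.
Context {R : realType}.

(** The ratio n / m = 5/2 keeps the slope of the last threshold, of order
    (3/2)^n / 3^m, bounded because 27 <= 32. *)
Lemma slope_parameters q i : (i < 5 * q)%N -> fold_slope (2 * q) i <= 1 :> R.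
Proof.
move=> iq; apply: (le_trans (fold_slope_mono _ (ltnW iq))).
rewrite /fold_slope /fold_level [3 ^+ _.+1]exprS [2 ^+ _.+2]exprS [2 ^+ _.+1]exprS.
rewrite (_ : _ * _ = 3 / 4 * (27 / 32) ^+ q); last first.
  rewrite (_ : 3 ^+ (5 * q) = (3 ^+ q) ^+ 5 :> R); last by rewrite -exprM mulnC.
  rewrite (_ : 3 ^+ (2 * q) = (3 ^+ q) ^+ 2 :> R); last by rewrite -exprM mulnC.
  rewrite (_ : 2 ^+ (5 * q) = (2 ^+ q) ^+ 5 :> R); last by rewrite -exprM mulnC.
  rewrite expr_div_n (_ : 27 = 3 ^+ 3 :> R); last by ring.
  rewrite (_ : 32 = 2 ^+ 5 :> R); last by ring.
  rewrite -!exprM ![(_ * q)%N]mulnC !exprM.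
  by field; rewrite !expf_neq0.
have : (27 / 32) ^+ q <= 1 :> R by rewrite exprn_ile1//; lra.
have : 0 <= (27 / 32) ^+ q :> R by rewrite exprn_ge0//; lra.
lra.
Qed.

(** The same ratio makes the bottom layer, where the slopes are not small, thinner
    than the elastic energy 4^-m of the layers because 16 <= 27. *)
Lemma bottom_depth q : layer_depth (2 * q) (5 * q) <= (16 ^+ q)^-1 :> R.
Proof.
rewrite /layer_depth.
rewrite (_ : _ / _ = (27 ^+ q)^-1); last first.
  rewrite (_ : 5 * q = 2 * q + 3 * q)%N; last by rewrite -mulnDl.
  rewrite exprD invfM mulrA divff ?expf_neq0// mul1r exprM; congr (_ ^+ _)^-1; ring.
rewrite lef_pV2 ?posrE ?exprn_gt0//.
by rewrite lerXn2r ?nnegrE//; lra.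
Qed.

Lemma fold_count q : (5 * q).+1%:R <= 6 * 4 ^+ q :> R.
Proof.
elim: q => [|q IH]; first by rewrite muln0 expr0; lra.
rewrite mulnS -addnS natrD exprS.
have : 1 <= 4 ^+ q :> R by rewrite exprn_ege1// ler1n.
lra.
Qed.

(** The period 4^-q of the wave in the middle of the cube should be comparable
    to eps^(1/3). *)
Lemma scale_choice (eps : R) : 0 < eps -> eps < 1 ->
  exists q : nat, eps * 64 ^+ q <= 1 /\ 1 < eps * 64 ^+ q.+1.
Proof.
move=> e0 e1.
have ex : exists k, 1 < eps * 64 ^+ k.
  have [k hk] : exists k : nat, eps^-1 < k%:R.
    by exists (Num.bound eps^-1); rewrite archi_boundP// invr_ge0 ltW.
  exists k; rewrite -ltr_pdivrMl// mulr1 (lt_le_trans hk)//.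
  rewrite -natrX ler_nat; exact/ltnW/ltn_expl.
case: (ex_minnP ex) => -[|k] hk hmin.
  by move: hk; rewrite expr0 mulr1 ltNge (ltW e1).
exists k; split => //; rewrite leNgt; apply/negP => /hmin.
by rewrite ltnn.
Qed.

Lemma energy_scales (eps : R) q : 0 < eps -> eps * 64 ^+ q <= 1 -> 1 < eps * 64 ^+ q.+1 ->
  (16 ^+ q)^-1 <= 16 * eps `^ (2 / 3) /\ eps * 4 ^+ q <= eps `^ (2 / 3).
Proof.
move=> e0 le gt; set t := eps `^ (1 / 3).
have t0 : 0 < t by exact: powR_gt0.
have t3 : t ^+ 3 = eps.
  by rewrite -powR_mulrn ?ltW// -powRrM mul1r mulVf ?powRr1 ?ltW// pnatr_eq0.
have t2 : eps `^ (2 / 3) = t ^+ 2.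
  by rewrite -powR_mulrn ?ltW// -powRrM; congr (_ `^ _); field.
have p4 : 0 < 4 ^+ q :> R by exact: exprn_gt0.
have E64 : 64 ^+ q = (4 ^+ q) ^+ 3 :> R.
  by rewrite -exprM mulnC exprM; congr (_ ^+ _); ring.
have E16 : 16 ^+ q = (4 ^+ q) ^+ 2 :> R.
  by rewrite -exprM mulnC exprM; congr (_ ^+ _); ring.
have le1 : t * 4 ^+ q <= 1.
  by rewrite -(expr_le1 (n := 3))// ?exprMn ?t3 -?E64// mulr_ge0 ?ltW.
have gt1 : 1 < 4 * (t * 4 ^+ q).
  rewrite -(expr_gt1 (n := 3))//; last by rewrite !mulr_ge0 ?ltW.
  rewrite !exprMn t3 -E64 (_ : 4 ^+ 3 * (eps * 64 ^+ q) = eps * 64 ^+ q.+1)//.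
  by rewrite [64 ^+ q.+1]exprS; ring.
rewrite t2 E16; split.
  rewrite -[leLHS]mul1r ler_pdivrMr ?exprn_gt0//.
  rewrite (_ : 16 * t ^+ 2 * _ = (4 * (t * 4 ^+ q)) ^+ 2); last by ring.
  by rewrite exprn_ege1// ltW.
by rewrite -t3 exprSr -mulrA ler_piMr// exprn_ge0// ltW.
Qed.

End Scales.

Theorem theorem4 (R : realType) :
  exists eps0 C : R, 0 < eps0 /\ 1 < C /\
    forall eps : R, 0 < eps -> eps < eps0 ->
      exists (u : 'cV[R]_3 -> 'cV[R]_3) (Du chi : 'cV[R]_3 -> 'M[R]_3),
        [/\ admissible (cubeOmega R) (Fhalf R) u Du,
            [lipschitz u x | x in cubeOmega R],
            BV (cubeOmega R) [set e2 R; e3 R] chi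
          & (elastic_energy (cubeOmega R) Du chi
             + eps%:E * surface_energy (cubeOmega R) chi
             <= (C * eps `^ (2 / 3))%:E)%E].
Proof.
(* 16 * (2916 + 1296) + 108 * (2 + 48 + 104) = 84024 *)
exists 1, (10 ^+ 5); split; first exact: ltr01; split.
  by rewrite exprn_egt1// ltr1n.
move=> eps e0 e1; have [q [le gt]] := scale_choice e0 e1.
have [el su] := energy_scales e0 le gt.
exists (displacement (2 * q) (5 * q)), (gradient (2 * q) (5 * q)), (strain (2 * q) (5 * q)).
have slopes := @slope_parameters R q.
split.
- exact: displacement_admissible.
- exact: displacement_lipschitz.
- exact: strain_BV.
have h1 := elastic_le slopes.
have h2 := strain_variation slopes.
have E4 : 4 ^+ (2 * q) = 16 ^+ q :> R by rewrite exprM; congr (_ ^+ _); ring.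
have E2 : 2 ^+ (2 * q) = 4 ^+ q :> R by rewrite exprM; congr (_ ^+ _); ring.
have h3 : (eps%:E * surface_energy (cubeOmega R) (strain (2 * q) (5 * q)) <=
    (eps * (108 * (2 + 8 * (5 * q).+1%:R + 104 * 2 ^+ (2 * q))))%:E)%E.
  by rewrite EFinM; apply: lee_wpmul2l => //; rewrite lee_fin ltW.
apply: (le_trans (leeD h1 h3)); rewrite -EFinD lee_fin E4 E2.
have bd := @bottom_depth R q; have fc := @fold_count R q.
have p4 : 1 <= 4 ^+ q :> R by rewrite exprn_ege1// ler1n.
have h4 : eps * (108 * (2 + 8 * (5 * q).+1%:R + 104 * 4 ^+ q)) <= 108 * (154 * (eps * 4 ^+ q)).
  rewrite mulrCA ler_pM2l// mulrCA ler_pM2l//; lra.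
have P0 : 0 <= eps `^ (2 / 3) by exact: powR_ge0.
lra.
Qed.
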